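(* There exists an absolute constant $\varepsilon>0$ such that the following holds. Let $n$ and $b$ be positive integers with $n/6\le b<n/4$ and $b\le (1/6+\varepsilon)n$. Then every graph $G$ on $n$ vertices with at least $\lfloor n^2/4\rfloor$ edges and book number $b(G)\le b$ which is not (isomorphic to) the balanced complete bipartite graph on $n$ vertices satisfies $$t(G)\ \ge\ b^2(n-4b),$$ with equality if and only if $G$ is isomorphic to $S_{b,n}$.
   Context: Graphs are finite and simple. $t(G)$ is the number of triangles of $G$. A book of size $k$ is a collection of $k$ triangles sharing a common edge; the book number $b(G)$ is the largest size of a book in $G$ (equivalently, the maximum over edges $xy$ of the number of common neighbors of $x$ and $y$). The balanced complete bipartite graph on $n$ vertices has parts of sizes $\lfloor n/2\rfloor$ and $\lceil n/2\rceil$. For integers $n,b$ with $n/6\le b\le n/4$, the graph $S_{b,n}$ is the following blow-up of the 3-prism: its vertex set is the disjoint union of six parts $U_1,U_2,U_3,V_1,V_2,V_3$ with $|U_1|=|U_2|=|V_1|=|V_2|=b$, $|U_3|=\lfloor (n-4b)/2\rfloor$, $|V_3|=\lceil (n-4b)/2\rceil$; for $i\ne j$ all edges between $U_i$ and $U_j$ and all edges between $V_i$ and $V_j$ are present; for each $i$ all edges between $U_i$ and $V_i$ are present; there are no other edges. *)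

(* Defs.v *)
From mathcomp Require Import all_boot.

Set Implicit Arguments.
Unset Strict Implicit.
Unset Printing Implicit Defensive.

Record sgraph := SGraph {
  vertex :> finType;
  adj : rel vertex;
  adj_sym : symmetric adj;
  adj_irrefl : irreflexive adj
}.

Definition isomorphic (G H : sgraph) : Prop :=
  exists f : G -> H, bijective f /\ forall x y, adj (f x) (f y) = adj x y.

Definition edges (G : sgraph) : {set {set G}} :=
  [set e | [exists x, [exists y, adj x y && (e == [set x; y])]]].

Definition triangles (G : sgraph) : {set {set G}} :=
  [set t : {set G} | (#|t| == 3) &&
     [forall x in t, [forall y in t, (x != y) ==> adj x y]]].

Definition is_book (G : sgraph) (B : {set {set G}}) : bool :=
  (B \subset triangles G) && [exists e in edges G, [forall t in B, e \subset t]].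

(* The empty collection is a book of size 0 as soon as [G] has an edge;
   the maximum over the empty family is 0, so [book_number G = 0] when
   [G] is triangle-free, including when it has no edge at all. *)
Definition book_number (G : sgraph) : nat := \max_(B : {set {set G}} | is_book B) #|B|.

Section CompleteBipartite.
Variables p q : nat.

Definition bip_adj : rel ('I_p + 'I_q) := fun x y =>
  match x, y with
  | inl _, inr _ | inr _, inl _ => true
  | _, _ => false
  end.

Lemma bip_adj_sym : symmetric bip_adj.
Proof. by case=> x [] y. Qed.

Lemma bip_adj_irrefl : irreflexive bip_adj.
Proof. by case. Qed.

Definition complete_bipartite : sgraph := SGraph bip_adj_sym bip_adj_irrefl.

End CompleteBipartite.

Definition balanced_complete_bipartite (n : nat) : sgraph :=
  complete_bipartite n./2 (uphalf n).

Section BlowUp.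
Variables (H : sgraph) (m : H -> nat).

Definition blowup_adj : rel {v : H & 'I_(m v)} :=
  fun x y => adj (tag x) (tag y).

Lemma blowup_adj_sym : symmetric blowup_adj.
Proof. by move=> x y; apply: adj_sym. Qed.

Lemma blowup_adj_irrefl : irreflexive blowup_adj.
Proof. by move=> x; apply: adj_irrefl. Qed.

Definition blowup : sgraph := SGraph blowup_adj_sym blowup_adj_irrefl.

End BlowUp.

(* [(false, i)] and [(true, i)] index the parts U_(i+1) and V_(i+1). *)
Definition prism_adj : rel (bool * 'I_3) := fun x y =>
  ((x.1 == y.1) && (x.2 != y.2)) || ((x.1 != y.1) && (x.2 == y.2)).

Lemma prism_adj_sym : symmetric prism_adj.
Proof. by move=> x y; rewrite /prism_adj [x.1 == _]eq_sym [x.2 == _]eq_sym. Qed.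

Lemma prism_adj_irrefl : irreflexive prism_adj.
Proof. by move=> x; rewrite /prism_adj !eqxx. Qed.

Definition prism : sgraph := SGraph prism_adj_sym prism_adj_irrefl.

(* The subtraction is truncated, so this is meaningful only for [4 * b <= n]. *)
Definition S_part_size (b n : nat) (x : prism) : nat :=
  if x.2 == ord_max then
    if x.1 then uphalf (n - 4 * b) else (n - 4 * b)./2
  else b.

Definition S_graph (b n : nat) : sgraph := blowup (S_part_size b n).

(* Main.v *)
Require Import Defs.
From mathcomp Require Import all_boot all_order all_algebra all_fingroup.
From mathcomp Require Import ring lra zify.
From mathcomp Require Import reals.

Set Implicit Arguments.
Unset Strict Implicit.
Unset Printing Implicit Defensive.

Import Order.TTheory GRing.Theory Num.Theory.
Local Open Scope ring_scope.

(** Why the theorem is true.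

Call an edge separated by a vertex [v] if [v] is adjacent to exactly one of its
ends.  Two of the three vertices of a triangle lie on the same side of the cut
given by the neighbourhood of [v], so every triangle has an edge that [v] does
not separate; as an edge lies in at most [b] triangles, the number [t] of
triangles is at most [b] times the number of edges that [v] does not separate.
Summed over [v], the numbers of unseparated edges give [6 t] minus half of a
[surplus], which is nonnegative when there are at least [n^2/4] edges.  Hence the
total [slack] of all inequalities used is at most a constant times [(6 b - n) t]
(lemma [sum_slack]), and [6 b - n] is tiny compared with [n].  If [t = 0] there is no slack at all:
every vertex separates every edge, and the graph is complete bipartite with
balanced parts ([triangle_free_isomorphic]).

Let [t > 0], and suppose that [t] is at most the claimed bound [b^2 (n - 4 b)].
For a triangle [xyz] chosen at random the following hold with high probability:
nearly every vertex is adjacent to one or two of [x, y, z], each of the edges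
[xy], [xz], [yz] lies in nearly [b] triangles, and the same is true after moving one vertex of the
triangle inside the common neighbourhood of the other two ([tri_exchange]).
Moving vertices twice gives [t >= c b^3] ([tau_lb]).  Now the slack at
nearly every vertex [v] is small against [b^3], and degrees are nearly [n/2], so
that [v] lies in nearly [t/(2b)] triangles, which is at most [b^2] by the
assumption on [t] ([tdeg_texcess]).  In a typical triangle the common
neighbourhoods already account for [b^2] triangles at each of [x, y, z], so the
vertices adjacent to [x] alone send almost no edges to the neighbours of [x].
The six classes of vertices adjacent to one or to two of [x, y, z] are therefore
an approximate blow-up of the prism ([near_prism_colouring]).

Next the classes are corrected ([clean_adj]).  Call a vertex typical if it is
adjacent to nearly all vertices that the prism prescribes.  A vertex whose typical
neighbours do not all lie in the classes adjacent to one and the same class has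
degree at most about [2 b] ([prism_fractional]).  Leave out every vertex of degree at most [13 b / 5], and
let each other vertex join the class whose neighbouring classes contain its
typical neighbours; then no edge between coloured vertices violates the prism.

It remains to count exactly.  With parts of sizes [b - a_i] and [b - c_i], with
[w] vertices left out and with some edges of the blow-up missing, both the number
of edges and the number of triangles are explicit up to the missing edges, and
[4 (t - b^2 (n - 4 b))] is at least [b] times the [excess_form]
[(sum a - sum c)^2 + 4 sum_(i <> j) a_i c_j] up to smaller terms ([excess_lower]).
The form dominates these terms: the cubic ones when the [a_i] and [c_i] are
nonnegative, being small against [b]; the contribution of [w] since vertices of low
degree cost edges ([strict_low]); and a negative [a_i] or [c_i] is paid for by the many
missing edges that a part larger than [b] forces ([oversize], [strict_over]).  The
form vanishes, or equals 1 for odd [n], exactly for the sizes of the parts of the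
extremal graph. *)

(** * Edges, triangles and books as sums over vertices *)

Section Cardinalities.
Local Open Scope nat_scope.
Variable G : sgraph.

Lemma adj_neq (x y : G) : adj x y -> x != y.
Proof. by apply: contraTneq => ->; rewrite adj_irrefl. Qed.

Lemma set2_eq (T : finType) (e : {set T}) x y :
  #|e| = 2 -> x \in e -> y \in e -> x != y -> e = [set x; y].
Proof.
move=> ce xe ye xy; apply/esym/eqP; rewrite eqEcard ce cards2 xy leqnn andbT.
by rewrite subUset !sub1set xe ye.
Qed.

Lemma cards3 (T : finType) (x y z : T) :
  x != y -> x != z -> y != z -> #|[set x; y; z]| = 3.
Proof.
move=> xy xz yz; rewrite setUC cardsU1 cards2 xy !inE.
by rewrite !(eq_sym z) (negPf xz) (negPf yz).
Qed.

Lemma set3_eq (T : finType) (t : {set T}) x y z :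
  #|t| = 3 -> x \in t -> y \in t -> z \in t ->
  x != y -> x != z -> y != z -> t = [set x; y; z].
Proof.
move=> ct xt yt zt xy xz yz; apply/esym/eqP.
rewrite eqEcard ct cards3 // leqnn andbT.
by rewrite !subUset !sub1set xt yt zt.
Qed.

Lemma card_edge e : e \in edges G -> #|e| = 2.
Proof.
by rewrite inE => /existsP[x /existsP[y /andP[/adj_neq xy /eqP->]]]; rewrite cards2 xy.
Qed.

Lemma edge_set2 (x y : G) : ([set x; y] \in edges G) = adj x y.
Proof.
apply/idP/idP => [|xy]; last first.
  by rewrite inE; apply/existsP; exists x; apply/existsP; exists y; rewrite xy eqxx.
rewrite inE => /existsP[u /existsP[v /andP[uv /eqP E]]].
have /adj_neq nuv := uv.
have xuv : x \in [set u; v] by rewrite -E !inE eqxx.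
have yuv : y \in [set u; v] by rewrite -E !inE eqxx orbT.
have nxy : x != y.
  by move: nuv; apply: contraNneq => xy; have := cards2 u v; rewrite -E xy cards2 eqxx; case: eqP.
move: xuv yuv nxy; rewrite !inE => /orP[]/eqP-> /orP[]/eqP->; rewrite ?eqxx //.
by rewrite adj_sym.
Qed.

(** Each edge is counted once for each of its two orientations. *)
Lemma sum_adj_edges : \sum_(x : G) \sum_(y : G) adj x y = 2 * #|edges G|.
Proof.
transitivity (\sum_(e in edges G) \sum_(x in e) \sum_(y in e :\ x) 1); last first.
  rewrite mulnC -sum_nat_const; apply: eq_bigr => e eG.
  have ce := card_edge eG.
  transitivity (\sum_(x in e) 1); last by rewrite sum_nat_const ce.
  apply: eq_bigr => x xe; rewrite sum_nat_const muln1.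
  by move: ce; rewrite (cardsD1 x) xe => -[].
symmetry; rewrite (exchange_big_dep xpredT) //=; apply: eq_bigr => x _.
rewrite (exchange_big_dep xpredT) //=; apply: eq_bigr => y _.
have [xy|xy] := boolP (adj x y).
  rewrite (big_pred1 [set x; y]) // => e /=; apply/idP/eqP => [|->].
    move=> /andP[/andP[eG xe]]; rewrite !inE => /andP[yx ye].
    by apply: set2_eq; rewrite ?(card_edge eG) // eq_sym.
  by rewrite edge_set2 xy !inE !eqxx orbT andbT /= eq_sym adj_neq.
rewrite big_pred0 // => e; apply/negP => /andP[/andP[eG xe]].
rewrite !inE => /andP[yx ye]; move: (xy); rewrite -edge_set2.
by rewrite -(@set2_eq _ e) ?eG ?(card_edge eG) // eq_sym.
Qed.

Lemma triangle_set3 (x y z : G) :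
  x != y -> x != z -> y != z ->
  ([set x; y; z] \in triangles G) = [&& adj x y, adj x z & adj y z].
Proof.
move=> xy xz yz; rewrite inE cards3 //=; apply/idP/idP => [|/and3P[axy axz ayz]].
  move=> /'forall_implyP tP.
  have memx : x \in [set x; y; z] by rewrite !inE eqxx.
  have memy : y \in [set x; y; z] by rewrite !inE eqxx orbT.
  have memz : z \in [set x; y; z] by rewrite !inE eqxx orbT.
  have /'forall_implyP tx := tP _ memx; have /'forall_implyP ty := tP _ memy.
  rewrite (implyP (tx y memy)) // (implyP (tx z memz)) //.
  by rewrite (implyP (ty z memz)).
apply/'forall_implyP => u; rewrite !inE -orbA => /or3P[]/eqP->;
apply/'forall_implyP => v; rewrite !inE -orbA => /or3P[]/eqP->;
by rewrite ?eqxx ?(adj_sym _ x) ?axy ?axz ?ayz ?implybT // adj_sym ?ayz ?axy ?axz ?implybT.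
Qed.

Lemma card_triangle (t : {set G}) : t \in triangles G -> #|t| = 3.
Proof. by rewrite inE => /andP[/eqP]. Qed.

(** Each triangle is counted once for each of the six orderings of its vertices. *)
Lemma sum_adj_triangles :
  \sum_(x : G) \sum_(y : G) \sum_(z : G) [&& adj x y, adj x z & adj y z] =
  6 * #|triangles G|.
Proof.
transitivity (\sum_(t in triangles G)
    \sum_(x in t) \sum_(y in t :\ x) \sum_(z in t :\ x :\ y) 1); last first.
  rewrite mulnC -sum_nat_const; apply: eq_bigr => t tG.
  have ct := card_triangle tG.
  transitivity (\sum_(x in t) 2); last by rewrite sum_nat_const ct.
  apply: eq_bigr => x xt; have cx : #|t :\ x| = 2.
    by move: ct; rewrite (cardsD1 x) xt => -[].
  transitivity (\sum_(y in t :\ x) 1); last by rewrite sum_nat_const cx.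
  apply: eq_bigr => y yt; rewrite sum_nat_const muln1.
  by move: cx; rewrite (cardsD1 y) yt => -[].
symmetry; rewrite (exchange_big_dep xpredT) //=; apply: eq_bigr => x _.
rewrite (exchange_big_dep xpredT) //=; apply: eq_bigr => y _.
rewrite (exchange_big_dep xpredT) //=; apply: eq_bigr => z _.
have [/and3P[xy xz yz]|nxyz] := boolP [&& _, _ & _].
  rewrite (big_pred1 [set x; y; z]) // => t /=; apply/idP/eqP => [|->].
    move=> /andP[/andP[/andP[tG xt]]]; rewrite !inE => /andP[yx yt].
    move=> /and3P[zy zx zt].
    by apply: set3_eq; rewrite ?(card_triangle tG) // eq_sym.
  rewrite triangle_set3 ?adj_neq // xy xz yz !inE !eqxx !orbT !andbT /=.
  by rewrite !(eq_sym z) (eq_sym y) !adj_neq.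
rewrite big_pred0 // => t; apply/negP.
move=> /andP[/andP[/andP[tG xt]]]; rewrite !inE => /andP[yx yt].
move=> /and3P[zy zx zt]; case/negP: nxyz.
rewrite -triangle_set3 1?eq_sym //.
by rewrite -(@set3_eq _ t) ?tG ?(card_triangle tG) // eq_sym.
Qed.

(** The triangles on the edge [xy], one for each common neighbour, form a book. *)
Lemma common_nbrs_le_book (x y : G) :
  adj x y -> #|[set z | adj x z && adj y z]| <= book_number G.
Proof.
move=> xy; pose B := [set [set x; y; z] | z in [set z | adj x z && adj y z]].
have inB z : adj x z && adj y z -> [set x; y; z] \in triangles G.
  by case/andP=> xz yz; rewrite triangle_set3 ?adj_neq // xy xz yz.
have <- : #|B| = #|[set z | adj x z && adj y z]|.
  apply: card_in_imset => z w; rewrite !inE => /andP[xz yz] /andP[xw yw] E.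
  have : z \in [set x; y; w] by rewrite -E !inE eqxx orbT.
  by rewrite !inE !(eq_sym z) (negPf (adj_neq xz)) (negPf (adj_neq yz)) /= => /eqP.
suff Bbook : is_book B.
  by rewrite /book_number (bigD1 B) //= leq_maxl.
apply/andP; split.
  by apply/subsetP => t /imsetP[z]; rewrite inE => /inB zt ->.
apply/existsP; exists [set x; y]; rewrite edge_set2 xy /=.
apply/forallP => t; apply/implyP => /imsetP[z _ ->].
exact: subsetUl.
Qed.

End Cardinalities.

(** * Triangles and the edges not separated by a vertex *)

Section Counting.
Variables (R : realFieldType) (G : sgraph).
Implicit Types (x y z u v w : G) (F : G -> G -> G -> R).

Definition adjR x y : R := (adj x y)%:R.
Definition deg x := \sum_y adjR x y.
Definition cod x y := \sum_z adjR x z * adjR y z.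
Definition far x y := \sum_z (1 - adjR x z) * (1 - adjR y z).
(** Twice the number of triangles at [v]. *)
Definition tdeg v := \sum_x \sum_y adjR x y * (adjR v x * adjR v y).
(** Sums over triangles run over ordered triples, so that averages of [F] can be
transformed by permuting and renaming the three vertices; every triangle counts
six times. *)
Definition tri F := \sum_x \sum_y \sum_z adjR x y * (adjR x z * adjR y z) * F x y z.
(** Six times the number of triangles. *)
Definition tau := tri (fun _ _ _ => 1).

(** The indicator that [v] does not separate [x] from [y]. *)
Definition same v x y : R := adjR v x * adjR v y + (1 - adjR v x) * (1 - adjR v y).
(** The indicator that [v] is adjacent to all or to none of [x, y, z]. *)
Definition mono v x y z : R :=
  adjR v x * adjR v y * adjR v z + (1 - adjR v x) * (1 - adjR v y) * (1 - adjR v z).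

Lemma adjRC x y : adjR x y = adjR y x.
Proof. by rewrite /adjR adj_sym. Qed.

Lemma adjR_ge0 x y : 0 <= adjR x y.
Proof. by rewrite /adjR ler0n. Qed.

Lemma adjR_le1 x y : adjR x y <= 1.
Proof. by rewrite /adjR lern1; case: adj. Qed.

Lemma adjR_compl_ge0 x y : 0 <= 1 - adjR x y.
Proof. by rewrite subr_ge0 adjR_le1. Qed.

Lemma tri_swap F : tri F = tri (fun x y z => F y x z).
Proof.
rewrite /tri exchange_big; apply: eq_bigr => x _; apply: eq_bigr => y _.
by apply: eq_bigr => z _; rewrite adjRC [adjR y z * _]mulrC.
Qed.

Lemma tri_rot F : tri F = tri (fun x y z => F x z y).
Proof.
rewrite /tri; apply: eq_bigr => x _; rewrite exchange_big.
apply: eq_bigr => y _; apply: eq_bigr => z _; rewrite (adjRC z y); ring.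
Qed.

Lemma tri_ge0 F : (forall x y z, adj x y -> adj x z -> adj y z -> 0 <= F x y z) -> 0 <= tri F.
Proof.
move=> F0; do 3![apply: sumr_ge0 => ? _]; rewrite /adjR.
case: (boolP (adj _ _)) => [xy|]; last by rewrite !mul0r.
case: (boolP (adj _ _)) => [xz|]; last by rewrite mul0r mulr0 mul0r.
case: (boolP (adj _ _)) => [yz|]; last by rewrite !mulr0 mul0r.
by rewrite !mul1r F0.
Qed.

Lemma triD F1 F2 : tri (fun x y z => F1 x y z + F2 x y z) = tri F1 + tri F2.
Proof.
rewrite /tri -big_split; apply: eq_bigr => x _; rewrite -big_split.
apply: eq_bigr => y _; rewrite -big_split.
by apply: eq_bigr => z _; rewrite mulrDr.
Qed.

Lemma triZ c F : tri (fun x y z => c * F x y z) = c * tri F.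
Proof.
rewrite /tri mulr_sumr; apply: eq_bigr => x _; rewrite mulr_sumr.
apply: eq_bigr => y _; rewrite mulr_sumr.
by apply: eq_bigr => z _; ring.
Qed.

Lemma triN F : tri (fun x y z => - F x y z) = - tri F.
Proof.
rewrite -mulN1r -triZ; apply: eq_bigr => x _; apply: eq_bigr => y _.
by apply: eq_bigr => z _; rewrite mulN1r.
Qed.

Lemma eq_tri F1 F2 : (forall x y z, F1 x y z = F2 x y z) -> tri F1 = tri F2.
Proof.
move=> E; apply: eq_bigr => x _; apply: eq_bigr => y _.
by apply: eq_bigr => z _; rewrite E.
Qed.

Lemma tri_cst c : tri (fun _ _ _ => c) = c * tau.
Proof. by rewrite /tau -triZ; apply: eq_tri => *; rewrite mulr1. Qed.

Lemma ler_tri F1 F2 : (forall x y z, adj x y -> adj x z -> adj y z -> F1 x y z <= F2 x y z) ->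
  tri F1 <= tri F2.
Proof.
move=> le; rewrite -subr_ge0 -triN -triD; apply: tri_ge0 => x y z xy xz yz.
by rewrite subr_ge0 le.
Qed.

Lemma tri_sum (I : finType) (F : I -> G -> G -> G -> R) :
  tri (fun x y z => \sum_i F i x y z) = \sum_i tri (F i).
Proof.
symmetry; rewrite /tri exchange_big; apply: eq_bigr => x _; rewrite exchange_big.
apply: eq_bigr => y _; rewrite exchange_big; apply: eq_bigr => z _.
by rewrite mulr_sumr.
Qed.

Lemma tri_edge (f : G -> G -> R) :
  tri (fun x y _ => f x y) = \sum_x \sum_y adjR x y * cod x y * f x y.
Proof.
apply: eq_bigr => x _; apply: eq_bigr => y _.
rewrite /cod mulr_sumr mulr_suml; apply: eq_bigr => z _; ring.
Qed.

Lemma tri_vertex (f : G -> R) : tri (fun x _ _ => f x) = \sum_x tdeg x * f x.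
Proof.
apply: eq_bigr => x _; rewrite /tdeg mulr_suml; apply: eq_bigr => y _.
rewrite mulr_suml; apply: eq_bigr => z _; ring.
Qed.

Lemma tau_edge : tau = \sum_x \sum_y adjR x y * cod x y.
Proof.
rewrite [LHS](tri_edge (fun _ _ => 1)); apply: eq_bigr => x _.
by apply: eq_bigr => y _; rewrite mulr1.
Qed.

Lemma tau_vertex : tau = \sum_x tdeg x.
Proof. by rewrite [LHS](tri_vertex (fun=> 1)); apply: eq_bigr => x _; rewrite mulr1. Qed.

Lemma tdeg_cod v : tdeg v = \sum_x adjR v x * cod v x.
Proof.
apply: eq_bigr => x _; rewrite mulr_sumr; apply: eq_bigr => y _; ring.
Qed.

Lemma cod_ge0 x y : 0 <= cod x y.
Proof. by apply: sumr_ge0 => z _; rewrite mulr_ge0 ?adjR_ge0. Qed.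

Lemma far_ge0 x y : 0 <= far x y.
Proof. by apply: sumr_ge0 => z _; rewrite mulr_ge0 ?adjR_compl_ge0. Qed.

Lemma tdeg_ge0 v : 0 <= tdeg v.
Proof. by rewrite tdeg_cod; apply: sumr_ge0 => x _; rewrite mulr_ge0 ?adjR_ge0 ?cod_ge0. Qed.

Lemma codC x y : cod x y = cod y x.
Proof. by apply: eq_bigr => z _; rewrite mulrC. Qed.

Lemma sum1G : \sum_(x : G) (1 : R) = #|G|%:R.
Proof. by rewrite sumr_const. Qed.

Lemma sum_cst (c : R) : \sum_(x : G) c = #|G|%:R * c.
Proof. by rewrite -sum1G mulr_suml; apply: eq_bigr => x _; rewrite mul1r. Qed.

Lemma cod_far x y : cod x y - far x y = deg x + deg y - #|G|%:R.
Proof.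
rewrite /cod /far /deg -sum1G -sumrB -big_split -sumrB.
apply: eq_bigr => z _ /=; ring.
Qed.

(** Twice the number of edges that [v] does not separate. *)
Definition uncut v := \sum_x \sum_y adjR x y * same v x y.
(** Twice the sum of the squares of the deviations of the degrees from [n/2], plus
[2 n] times the number of edges above [n^2/4]. *)
Definition surplus := \sum_x deg x * (2 * deg x - #|G|%:R).

Lemma same_ge0 v x y : 0 <= same v x y.
Proof. by rewrite addr_ge0 ?mulr_ge0 ?adjR_ge0 ?adjR_compl_ge0. Qed.

Lemma mono_ge0 v x y z : 0 <= mono v x y z.
Proof. by rewrite addr_ge0 ?mulr_ge0 ?adjR_ge0 ?adjR_compl_ge0. Qed.

(** Of the three edges of a triangle, [v] leaves one or three unseparated, the latter
exactly when the triangle is monochromatic for [v]. *)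
Lemma tau_mono v :
  tau + 2 * tri (mono v) = 3 * \sum_x \sum_y adjR x y * cod x y * same v x y.
Proof.
have E1 : tri (fun x y z => same v x z) = tri (fun x y _ => same v x y).
  by rewrite tri_rot.
have E2 : tri (fun x y z => same v y z) = tri (fun x y _ => same v x y).
  by rewrite tri_swap E1.
rewrite -tri_edge -triZ /tau -triD.
transitivity (tri (fun x y z => same v x y + same v x z + same v y z)).
  by apply: eq_tri => x y z; rewrite /mono /same; ring.
rewrite (triD (fun x y z => same v x y + same v x z) (fun x y z => same v y z)).
rewrite (triD (fun x y z => same v x y) (fun x y z => same v x z)) E1 E2; ring.
Qed.

(** An edge [xy] is not separated by its common neighbours nor by its common
non-neighbours, and the difference of their numbers is a function of the
degrees. *)
Lemma sum_uncut : \sum_v uncut v = 2 * tau - surplus.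
Proof.
rewrite /uncut exchange_big /=.
have -> : surplus = \sum_x \sum_y adjR x y * (deg x + deg y - #|G|%:R).
  transitivity (\sum_x \sum_y adjR x y * (deg x - #|G|%:R / 2) +
                \sum_x \sum_y adjR x y * (deg y - #|G|%:R / 2)).
    rewrite [X in _ = _ + X]exchange_big /= -big_split; apply: eq_bigr => x _.
    under [X in _ = _ + X]eq_bigr => y _ do rewrite adjRC.
    rewrite -!mulr_suml /= -/(deg x); lra.
  rewrite -big_split; apply: eq_bigr => x _; rewrite -big_split.
  apply: eq_bigr => y _ /=; lra.
rewrite tau_edge mulr_sumr -sumrB; apply: eq_bigr => x _.
rewrite exchange_big /= mulr_sumr -sumrB; apply: eq_bigr => y _.
rewrite -mulr_sumr.
have -> : \sum_v same v x y = cod x y + far x y.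
  rewrite -big_split; apply: eq_bigr => v _; rewrite /same /=.
  by rewrite (adjRC v x) (adjRC v y).
rewrite -cod_far; ring.
Qed.

Variable b : R.
Hypothesis cod_le : forall x y, adj x y -> cod x y <= b.

(** The defect, at the vertex [v], of the inequality saying that each triangle
contains one of the edges not separated by [v], each of them lying in at most
[b] triangles. *)
Definition slack v := 3 * b * uncut v - tau.

Lemma slackE v : slack v =
  2 * tri (mono v) + 3 * \sum_x \sum_y adjR x y * (b - cod x y) * same v x y.
Proof.
have -> : \sum_x \sum_y adjR x y * (b - cod x y) * same v x y =
  b * uncut v - \sum_x \sum_y adjR x y * cod x y * same v x y.
  rewrite /uncut mulr_sumr -sumrB; apply: eq_bigr => x _.
  by rewrite mulr_sumr -sumrB; apply: eq_bigr => y _; ring.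
have := tau_mono v; rewrite /slack; lra.
Qed.

Lemma adjR_gap_ge0 x y : 0 <= adjR x y * (b - cod x y).
Proof.
rewrite /adjR; have [xy|_] := boolP (adj x y); last by rewrite mul0r.
by rewrite mul1r subr_ge0 cod_le.
Qed.

Lemma slack_ge0 v : 0 <= slack v.
Proof.
rewrite slackE addr_ge0 // mulr_ge0 //; first by apply: tri_ge0 => *; apply: mono_ge0.
by do 2![apply: sumr_ge0 => ? _]; rewrite mulr_ge0 ?adjR_gap_ge0 ?same_ge0.
Qed.

(** As [surplus] is nonnegative for dense graphs, the total slack is at most
[(6 b - n) tau]: this is the source of all stability below. *)
Lemma sum_slack : \sum_v slack v = (6 * b - #|G|%:R) * tau - 3 * b * surplus.
Proof.
rewrite sumrB -mulr_sumr sum_uncut sumr_const -mulr_natl; ring.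
Qed.

Definition mono_count x y z := \sum_v mono v x y z.

(** The slack in terms of the nonnegative quantities that have to be small in a
stable configuration. *)
Lemma sum_slackE : \sum_v slack v =
  2 * tri mono_count + 3 * \sum_x \sum_y adjR x y * (b - cod x y) * (cod x y + far x y).
Proof.
rewrite tri_sum mulr_sumr; transitivity (\sum_v 2 * tri (mono v) +
  \sum_v 3 * \sum_x \sum_y adjR x y * (b - cod x y) * same v x y).
  by rewrite -big_split; apply: eq_bigr => v _; apply: slackE.
congr (_ + _); rewrite -mulr_sumr; congr (_ * _).
rewrite exchange_big; apply: eq_bigr => x _; rewrite exchange_big.
apply: eq_bigr => y _; rewrite -mulr_sumr; congr (_ * _).
rewrite -big_split; apply: eq_bigr => v _; rewrite /same /=.
by rewrite (adjRC v x) (adjRC v y).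
Qed.

Definition gap x y := b - cod x y.

Lemma mono_count_ge0 x y z : 0 <= mono_count x y z.
Proof. by apply: sumr_ge0 => v _; apply: mono_ge0. Qed.

Lemma tri_gap : tri (fun x y _ => gap x y) <= \sum_x \sum_y adjR x y * (b - cod x y) * (cod x y + far x y).
Proof.
rewrite tri_edge; apply: ler_sum => x _; apply: ler_sum => y _.
rewrite mulrAC ler_wpM2l ?adjR_gap_ge0 // lerDl far_ge0 //.
Qed.

(** Replacing the third vertex of a random triangle by a random common neighbour of
the first two is an averaging that costs at most a factor [b], so a property of
most triangles survives it. *)
Lemma tri_exchange F : (forall x y z, adj x y -> adj x z -> adj y z -> 0 <= F x y z) ->
  tri (fun x y _ => \sum_u adjR x u * adjR y u * F x y u) <= b * tri F.
Proof.
move=> F0; rewrite tri_edge [tri F]/tri mulr_sumr; apply: ler_sum => x _.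
rewrite mulr_sumr; apply: ler_sum => y _; rewrite [adjR x y * _]mulrC -mulrA mulr_sumr.
have -> : \sum_u adjR x y * (adjR x u * adjR y u * F x y u) =
  \sum_z adjR x y * (adjR x z * adjR y z) * F x y z.
  by apply: eq_bigr => u _; ring.
have [xy|nxy] := boolP (adj x y); last first.
  by rewrite !big1 ?mulr0 // => z _; rewrite /adjR (negPf nxy) !mul0r.
rewrite ler_wpM2r ?cod_le //; apply: sumr_ge0 => z _; rewrite /adjR xy mul1r.
case: (boolP (adj _ _)) => [xz|]; last by rewrite !mul0r.
case: (boolP (adj _ _)) => [yz|]; last by rewrite mulr0 mul0r.
by rewrite !mul1r F0.
Qed.

End Counting.

(** * Degrees of dense graphs *)

Lemma sqr_div4 m : (m ^ 2 = m ^ 2 %/ 4 * 4 + odd m)%N.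
Proof.
rewrite {1}(divn_eq (m ^ 2) 4); congr addn.
rewrite -{1}(odd_double_half m) sqrnD -muln2 expnMn.
by case: odd; rewrite ?mul1n ?mul0n ?add0n; lia.
Qed.

Section Degrees.
Variables (R : realFieldType) (G : sgraph).
Local Notation n := (#|G|%:R : R).
Local Notation deg := (@deg R G).
Local Notation o := ((odd #|G|)%:R : R).
Hypothesis dense : (#|G| ^ 2 %/ 4 <= #|edges G|)%N.

Definition dev (x : G) : R := 2 * deg x - n.

Lemma deg_card (x : G) : deg x = #|[set y | adj x y]|%:R.
Proof.
rewrite /deg /adjR -sum1dep_card natr_sum [RHS]big_mkcond /=.
by apply: eq_bigr => y _; case: adj.
Qed.

Lemma sum_deg : \sum_x deg x = 2 * #|edges G|%:R.
Proof.
rewrite -[2]/(2%:R) -natrM -sum_adj_edges natr_sum; apply: eq_bigr => x _.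
by rewrite natr_sum.
Qed.

(** The parity term is the price of rounding [n^2/4] down. *)
Lemma sum_dev : - o <= \sum_x dev x.
Proof.
have : (#|G| ^ 2 - odd #|G| <= 4 * #|edges G|)%N.
  have := sqr_div4 #|G|.
  lia.
rewrite leq_subLR => le1; have : (#|G| ^ 2)%:R <= (odd #|G| + 4 * #|edges G|)%:R :> R.
  by rewrite ler_nat.
rewrite natrD natrM natrX => le2.
rewrite sumrB -mulr_sumr sum_deg sumr_const -[n *+ _]mulr_natl; lra.
Qed.

(** Degrees cannot equal [n/2] when [n] is odd. *)
Lemma dev_sqr x : o <= dev x ^+ 2.
Proof.
rewrite /dev deg_card; set d := #|[set _ | _]|.
case: (boolP (odd #|G|)) => [oG|_]; last by rewrite sqr_ge0.
have [le|gt] := leqP (2 * d).+1 #|G|.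
  have : (2 * d).+1%:R <= n :> R by rewrite ler_nat.
  rewrite -natr1 natrM => h; rewrite -subr_ge0.
  have : 0 <= (n - 2 * d%:R - 1) * (n - 2 * d%:R + 1) by rewrite mulr_ge0 //; lra.
  by rewrite /=; lra.
have lt' : (#|G| < 2 * d)%N.
  by rewrite ltn_neqAle -ltnS gt andbT; apply: contraL oG => /eqP->; lia.
have : #|G|.+1%:R <= (2 * d)%:R :> R by rewrite ler_nat.
rewrite -natr1 natrM => h; rewrite -subr_ge0.
have : 0 <= (2 * d%:R - n - 1) * (2 * d%:R - n + 1) by rewrite mulr_ge0 //; lra.
by rewrite /=; lra.
Qed.

Lemma surplusE : 2 * surplus R G = \sum_x dev x ^+ 2 + n * \sum_x dev x.
Proof.
rewrite /surplus mulr_sumr mulr_sumr -big_split; apply: eq_bigr => x _ /=.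
rewrite /dev; ring.
Qed.

Lemma sum_dev_sqr : \sum_x dev x ^+ 2 <= 2 * surplus R G + n * o.
Proof.
rewrite surplusE -subr_ge0.
have : 0 <= n * (o + \sum_x dev x) by rewrite mulr_ge0 // addrC -lerBlDr sub0r sum_dev.
lra.
Qed.

(** For odd [n] the rounding loss in the number of edges is compensated by the
unavoidable deviation of every degree from [n/2]. *)
Lemma surplus_ge0 : 0 <= surplus R G.
Proof.
have : n * o <= \sum_x dev x ^+ 2.
  rewrite mulrC mulr_natr -sumr_const; apply: ler_sum => x _; exact: dev_sqr.
have : 0 <= n * (o + \sum_x dev x) by rewrite mulr_ge0 // addrC -lerBlDr sub0r sum_dev.
by have := surplusE; lra.
Qed.

Lemma uncutE v : uncut R v = 2 * tdeg R v - \sum_x deg x * (2 * adjR R v x - 1).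
Proof.
have -> : \sum_x deg x * (2 * adjR R v x - 1) =
  \sum_x \sum_y adjR R x y * (adjR R v x + adjR R v y - 1).
  have E : \sum_x \sum_y adjR R x y * adjR R v y = \sum_x \sum_y adjR R x y * adjR R v x.
    rewrite exchange_big; apply: eq_bigr => x _; apply: eq_bigr => y _.
    by rewrite adjRC.
  transitivity (\sum_x \sum_y adjR R x y * (adjR R v x - 1) + \sum_x \sum_y adjR R x y * adjR R v y).
    rewrite E -big_split; apply: eq_bigr => x _ /=; rewrite -!mulr_suml -/(deg x); ring.
  rewrite -big_split; apply: eq_bigr => x _ /=; rewrite -big_split.
  by apply: eq_bigr => y _ /=; ring.
rewrite /uncut /tdeg mulr_sumr -sumrB; apply: eq_bigr => x _.
rewrite mulr_sumr -sumrB; apply: eq_bigr => y _; rewrite /same; ring.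
Qed.

Lemma sum_deg_sign v : \sum_x deg x * (2 * adjR R v x - 1) =
  (\sum_x dev x * (2 * adjR R v x - 1)) / 2 + n / 2 * dev v.
Proof.
have -> : dev v = \sum_x (2 * adjR R v x - 1).
  by rewrite sumrB -mulr_sumr sumr_const.
rewrite mulr_suml mulr_sumr -big_split; apply: eq_bigr => x _ /=.
by rewrite /dev; field.
Qed.

Definition total_dev := \sum_x `|dev x|.

(** The numbers of edges inside the neighbourhood of [v] and inside its complement
differ only through deviations of degrees from [n/2]; their sum is the number of
edges not separated by [v]. *)
Lemma tdeg_uncut v : 2 * tdeg R v <= uncut R v + total_dev / 2 + n / 2 * `|dev v|.
Proof.
have : uncut R v = 2 * tdeg R v - ((\sum_x dev x * (2 * adjR R v x - 1)) / 2 + n / 2 * dev v).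
  by rewrite -sum_deg_sign uncutE.
have : \sum_x dev x * (2 * adjR R v x - 1) <= total_dev.
  apply: ler_sum => x _; apply: le_trans (ler_norm _) _.
  by rewrite normrM /adjR; case: adj; rewrite ?mulr1 ?mulr0 ?sub0r ?normrN -?[2]natr1 ?addrK normr1 mulr1.
have : n / 2 * dev v <= n / 2 * `|dev v| by rewrite ler_wpM2l ?ler_norm // divr_ge0.
lra.
Qed.

Lemma total_dev_le (lam : R) : 0 < lam ->
  total_dev <= (\sum_x dev x ^+ 2) / (2 * lam) + n * lam / 2.
Proof.
move=> l0.
have -> : n * lam / 2 = \sum_(x : G) lam / 2 by rewrite sumr_const -[RHS]mulr_natl; ring.
rewrite mulr_suml -big_split /=; apply: ler_sum => x _.
rewrite -subr_ge0.
have -> : dev x ^+ 2 / (2 * lam) + lam / 2 - `|dev x| =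
  (`|dev x| - lam) ^+ 2 / (2 * lam).
  rewrite -[dev x ^+ 2]real_normK ?num_real //; field; lra.
by rewrite divr_ge0 ?sqr_ge0 //; lra.
Qed.

End Degrees.

(** * Averages over triangles *)

Section Averaging.
Variables (R : realFieldType) (G : sgraph) (b : R).
Implicit Types (x y z u v w : G).
Local Notation n := (#|G|%:R : R).
Local Notation ind := (@adjR R G).
Local Notation cod := (@cod R G).
Local Notation tdeg := (@tdeg R G).
Local Notation tau := (@tau R G).
Local Notation gap := (@gap R G b).

Hypothesis cod_le : forall x y, adj x y -> cod x y <= b.
Hypothesis surplus0 : 0 <= surplus R G.
Hypothesis b_gt0 : 0 < b.

Let defect := 6 * b - n.

Lemma tri_mono_count_le : 2 * tri (@mono_count R G) <= defect * tau.
Proof.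
have := sum_slackE G b; rewrite (sum_slack G b).
have := tri_gap cod_le; have : 0 <= tri (fun x y _ => gap x y).
  by apply: tri_ge0 => x y z xy _ _; rewrite subr_ge0 cod_le.
have : 0 <= b * surplus R G by rewrite mulr_ge0 // ltW.
rewrite /defect; lra.
Qed.

Lemma tri_gap_le : 3 * tri (fun x y _ => gap x y) <= defect * tau.
Proof.
have := sum_slackE G b; rewrite (sum_slack G b).
have := tri_gap cod_le; have : 0 <= tri (@mono_count R G).
  by apply: tri_ge0 => x y z *; apply: mono_count_ge0.
have : 0 <= b * surplus R G by rewrite mulr_ge0 // ltW.
rewrite /defect; lra.
Qed.

Lemma sum_slack_le : \sum_(v : G) slack b v <= defect * tau.
Proof.
rewrite (sum_slack G b) /defect gerBl.
by rewrite !mulr_ge0 // ltW.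
Qed.

Lemma surplus_le : 3 * b * surplus R G <= defect * tau.
Proof.
have := sum_slack G b; have : 0 <= \sum_(v : G) slack b v.
  by apply: sumr_ge0 => v _; apply: slack_ge0.
rewrite /defect; lra.
Qed.

Lemma tri_perm (f : G -> G -> R) :
  [/\ tri (fun x y z => f y x) = tri (fun x y z => f x y),
      tri (fun x y z => f x z) = tri (fun x y z => f x y),
      tri (fun x y z => f z x) = tri (fun x y z => f x y),
      tri (fun x y z => f y z) = tri (fun x y z => f x y) &
      tri (fun x y z => f z y) = tri (fun x y z => f x y)].
Proof.
have E1 (g : G -> G -> R) : tri (fun x y z => g y x) = tri (fun x y z => g x y).
  by rewrite tri_swap.
have E2 (g : G -> G -> R) : tri (fun x y z => g x z) = tri (fun x y z => g x y).
  by rewrite tri_rot.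
have E4 (g : G -> G -> R) : tri (fun x y z => g y z) = tri (fun x y z => g x y).
  by rewrite tri_swap E2.
split=> //.
- by rewrite (E2 (fun x z => f z x)) E1.
- by rewrite (E4 (fun y z => f z y)) E1.
Qed.

(** What [tri_exchange] controls when [gap] is taken on the edge from [x] to the exchanged vertex. *)
Definition linkgap x y := \sum_u ind x u * ind y u * gap x u.

Lemma tri_linkgap : tri (fun x y _ => linkgap x y) <= b * tri (fun x y _ => gap x y).
Proof.
have [_ <- _ _ _] := tri_perm gap.
apply: (tri_exchange cod_le (F := fun x _ u => gap x u)) => x y z _ xz _.
by rewrite subr_ge0 cod_le.
Qed.

Lemma linkgap_cod x y : \sum_u ind x u * ind y u * cod x u = b * cod x y - linkgap x y.
Proof.
rewrite {2}/cod mulr_sumr -sumrB; apply: eq_bigr => u _; rewrite /gap; ring.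
Qed.

Definition tdefect x y := b * gap x y + linkgap x y.

(** The common neighbours of an edge [xy] alone produce nearly [b] triangles each
on the edges joining them to [x]. *)
Lemma tdeg_lb x y : b ^+ 2 - tdefect x y <= tdeg x.
Proof.
have : \sum_u ind x u * ind y u * cod x u <= tdeg x.
  rewrite tdeg_cod; apply: ler_sum => u _; rewrite ler_wpM2r ?cod_ge0 //.
  by rewrite ler_piMr ?adjR_ge0 ?adjR_le1.
rewrite linkgap_cod /tdefect /gap; lra.
Qed.

Lemma gap_ge0 x y : adj x y -> 0 <= gap x y.
Proof. by move=> xy; rewrite subr_ge0 cod_le. Qed.

Lemma linkgap_ge0 x y : 0 <= linkgap x y.
Proof.
apply: sumr_ge0 => u _; rewrite /adjR; case: (boolP (adj x u)) => xu; last by rewrite !mul0r.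
by rewrite mul1r mulr_ge0 ?gap_ge0.
Qed.

Lemma tdefect_ge0 x y : adj x y -> 0 <= tdefect x y.
Proof. by move=> xy; rewrite addr_ge0 ?linkgap_ge0 // mulr_ge0 ?gap_ge0 // ltW. Qed.

Lemma tri_tdefect : tri (fun x y _ => tdefect x y) <= 2 * b * tri (fun x y _ => gap x y).
Proof.
rewrite triD triZ; have := tri_linkgap; lra.
Qed.

(** As soon as there is one triangle there are about [b^3/6]: by two exchanges a
typical edge has nearly [b] common neighbours, each in nearly [b^2] ordered
triangles. *)
Lemma tau_lb : 0 < tau -> b ^+ 2 * (b - defect) <= tau.
Proof.
move=> tau0.
have lb x y : b ^+ 3 - b ^+ 2 * gap x y - \sum_u ind x u * ind y u * tdefect u x <= tau.
  rewrite tau_vertex.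
  apply: (@le_trans _ _ (\sum_u ind x u * ind y u * (b ^+ 2 - tdefect u x))); last first.
    apply: ler_sum => u _; apply: (@le_trans _ _ (ind x u * ind y u * tdeg u)).
      by rewrite ler_wpM2l ?mulr_ge0 ?adjR_ge0 ?tdeg_lb.
    by rewrite ler_piMl ?tdeg_ge0 // mulr_ile1 ?adjR_ge0 ?adjR_le1.
  rewrite le_eqVlt; apply/orP; left; apply/eqP.
  have -> : \sum_u ind x u * ind y u * (b ^+ 2 - tdefect u x) =
    b ^+ 2 * cod x y - \sum_u ind x u * ind y u * tdefect u x.
    by rewrite {1}/cod mulr_sumr -sumrB; apply: eq_bigr => u _; ring.
  by rewrite /gap; ring.
have ex : tri (fun x y _ => \sum_u ind x u * ind y u * tdefect u x) <=
    b * tri (fun x y _ => tdefect x y).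
  have [_ _ <- _ _] := tri_perm tdefect.
  apply: (tri_exchange cod_le (F := fun x _ u => tdefect u x)) => x y z _ xz _.
  by rewrite tdefect_ge0 // adj_sym.
have : tri (fun x y _ => b ^+ 3 - b ^+ 2 * gap x y - \sum_u ind x u * ind y u * tdefect u x)
   <= tri (fun _ _ _ : G => tau).
  by apply: (@ler_tri R G) => x y z _ _ _; apply: lb.
rewrite tri_cst (triD (fun x y _ => b ^+ 3 - b ^+ 2 * gap x y)) triN.
rewrite (triD (fun _ _ _ => b ^+ 3)) tri_cst triN triZ => le1.
rewrite -(ler_pM2r tau0).
have td := tri_tdefect; have gp := tri_gap_le.
have : b * tri (fun x y _ => tdefect x y) <= b * (2 * b * tri (fun x y _ => gap x y)).
  by rewrite ler_wpM2l // ltW.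
have : b ^+ 2 * (3 * tri (fun x y _ => gap x y)) <= b ^+ 2 * (defect * tau).
  by rewrite ler_wpM2l // sqr_ge0.
lra.
Qed.

End Averaging.

(** * A typical triangle *)

Section GoodTriangle.
Variables (R : realFieldType) (G : sgraph) (b mu : R).
Implicit Types (x y z u v w : G).
Local Notation n := (#|G|%:R : R).
Local Notation ind := (@adjR R G).
Local Notation cod := (@cod R G).
Local Notation tdeg := (@tdeg R G).
Local Notation tau := (@tau R G).
Local Notation gap := (@gap R G b).
Local Notation dev := (@dev R G).
Local Notation devsum := (@total_dev R G).
Local Notation linkgap := (@linkgap R G b).
Local Notation o := ((odd #|G|)%:R : R).

Hypothesis dense : (#|G| ^ 2 %/ 4 <= #|edges G|)%N.
Hypothesis cod_le : forall x y, adj x y -> cod x y <= b.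
Hypothesis b_ge1 : 1 <= b.
Hypothesis n_le : n <= 6 * b.
Hypothesis mu_gt0 : 0 < mu.
Hypothesis mu_le : 2 * mu <= 1.
Hypothesis defect_le : 6 * b - n <= mu ^+ 2 * b.
Hypothesis odd_le : o <= 6 * b - n.
Hypothesis tau_gt0 : 0 < tau.
Hypothesis tau_le : tau <= 12 * b ^+ 3.

Let b_gt0 : 0 < b. Proof. exact: lt_le_trans ltr01 b_ge1. Qed.
Let b_ge0 : 0 <= b. Proof. exact: ltW. Qed.
Let mu2 : mu ^+ 2 <= mu / 2.
Proof.
have : mu * (2 * mu) <= mu * 1 by rewrite ler_wpM2l // ltW.
lra.
Qed.
Let surplus0 := surplus_ge0 R dense.

Let defect_tau : (6 * b - n) * tau <= mu ^+ 2 * b * tau.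
Proof. by rewrite ler_wpM2r // ltW. Qed.

Let tau_ge : b ^+ 3 <= 2 * tau.
Proof.
apply: le_trans (_ : 2 * (b ^+ 2 * (b - (6 * b - n))) <= _); last first.
  by rewrite ler_pM2l //; apply: tau_lb.
have : b ^+ 2 * (6 * b - n) <= b ^+ 2 * (mu ^+ 2 * b).
  by rewrite ler_wpM2l ?sqr_ge0.
have : mu ^+ 2 * b ^+ 3 <= 1 / 2 * b ^+ 3.
  by rewrite ler_wpM2r ?exprn_ge0 //; move: mu2 mu_le; lra.
lra.
Qed.

Lemma total_dev_small : devsum <= 10 * mu * b ^+ 2.
Proof.
have s1 : surplus R G <= 4 * mu ^+ 2 * b ^+ 3.
  have p : 0 < 3 * b by rewrite mulr_gt0.
  rewrite -(ler_pM2l p); have := surplus_le cod_le; move: defect_tau.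
  have : mu ^+ 2 * b * tau <= mu ^+ 2 * b * (12 * b ^+ 3).
    by rewrite ler_wpM2l // mulr_ge0 ?sqr_ge0.
  lra.
have s2 : n * o <= 6 * mu ^+ 2 * b ^+ 3.
  have : n * o <= 6 * b * (mu ^+ 2 * b).
    apply: ler_pM => //; exact: le_trans odd_le defect_le.
  have : mu ^+ 2 * b ^+ 2 * 1 <= mu ^+ 2 * b ^+ 2 * b.
    by rewrite ler_wpM2l // mulr_ge0 ?sqr_ge0.
  lra.
have s3 := sum_dev_sqr R dense.
(* This choice balances the two terms of the bound. *)
have mb : 0 < mu * b by rewrite mulr_gt0.
apply: le_trans (total_dev_le G mb) _.
have -> : 10 * mu * b ^+ 2 = 14 * mu ^+ 2 * b ^+ 3 / (2 * (mu * b)) + 6 * b * (mu * b) / 2.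
  by field; rewrite !gt_eqF.
apply: lerD.
  have i0 : 0 <= (2 * (mu * b))^-1 by rewrite invr_ge0 mulr_ge0 // ltW.
  by rewrite ler_wpM2r //; lra.
have : n * (mu * b) <= 6 * b * (mu * b) by rewrite ler_wpM2r ?(ltW mb).
lra.
Qed.

(** A bound on how far the vertex [v] may exceed its fair share of triangles. *)
Definition texcess v : R := slack b v + 3 * b * (devsum / 2 + n / 2 * `|dev v|).

Lemma total_dev_ge0 : 0 <= devsum.
Proof. by apply: sumr_ge0 => x _. Qed.

Lemma texcess_ge0 v : 0 <= texcess v.
Proof.
rewrite addr_ge0 ?slack_ge0 // mulr_ge0 //; first by rewrite mulr_ge0.
by rewrite addr_ge0 // ?divr_ge0 ?total_dev_ge0 // mulr_ge0 ?divr_ge0.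
Qed.

(** Few edges are not separated by [v], up to its slack, and half of them lie in
the neighbourhood of [v], up to the deviations of degrees.  The assumed upper
bound on [tau] enters here. *)
Lemma tdeg_texcess v : tdeg v <= 2 * b ^+ 2 + texcess v / (6 * b).
Proof.
have p : 0 < 6 * b by rewrite mulr_gt0.
rewrite -(ler_pM2l p).
have -> : 6 * b * (2 * b ^+ 2 + texcess v / (6 * b)) = 12 * b ^+ 3 + texcess v.
  by field; rewrite gt_eqF.
have : 3 * b * (2 * tdeg v) <= 3 * b * (uncut R v + devsum / 2 + n / 2 * `|dev v|).
  by rewrite ler_pM2l ?tdeg_uncut // mulr_gt0.
move: tau_le; rewrite /texcess /slack; lra.
Qed.

Lemma tdeg_ub v : tdeg v <= 6 * b ^+ 2.
Proof.
apply: le_trans (_ : n * b <= _); last first.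
  by have := n_le; rewrite -(ler_pM2r b_gt0); lra.
rewrite tdeg_cod; apply: le_trans (_ : \sum_(x : G) b <= _).
  apply: ler_sum => x _; rewrite /adjR; case: (boolP (adj v x)) => vx.
    by rewrite mul1r cod_le.
  by rewrite mul0r.
by rewrite sumr_const -[b *+ _]mulr_natl.
Qed.

Lemma sum_texcess : \sum_v texcess v <= 361 * mu * b * tau.
Proof.
have -> : \sum_v texcess v = \sum_(v : G) slack b v + 3 * b * (n * devsum).
  rewrite /texcess big_split /=; congr (_ + _); rewrite -mulr_sumr; congr (_ * _).
  rewrite big_split /= sum_cst -mulr_sumr -/(total_dev R G); by field.
have s1 := sum_slack_le surplus0 b_gt0.
have s2 : b * (n * devsum) <= b * (6 * b * (10 * mu * b ^+ 2)).
  by rewrite ler_pM2l // ler_pM ?total_dev_ge0 ?total_dev_small.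
have s3 : mu * b * b ^+ 3 <= mu * b * (2 * tau) by rewrite ler_pM2l ?mulr_gt0.
have s4 : mu ^+ 2 * b * tau <= mu * b * tau.
  rewrite -!(mulrA _ b) ler_wpM2r //; first by rewrite mulr_ge0 // ltW.
  by move: mu2 mu_gt0; lra.
move: defect_tau; lra.
Qed.

(** A vertex is in at most [3 b^2] triangles, so a small total excess stays small when
vertices are weighted by their triangles; [tau_lb] makes it small against [tau]. *)
Lemma tri_texcess : tri (fun x _ _ => texcess x / (6 * b)) <= 361 * mu * b ^+ 2 * tau.
Proof.
rewrite tri_vertex; apply: le_trans (_ : \sum_x b * texcess x <= _).
  apply: ler_sum => x _.
  have -> : b * texcess x = 6 * b ^+ 2 * (texcess x / (6 * b)).
    by field; rewrite gt_eqF.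
  by rewrite ler_wpM2r ?tdeg_ub // divr_ge0 ?texcess_ge0 // mulr_ge0.
rewrite -mulr_sumr; have : b * \sum_v texcess v <= b * (361 * mu * b * tau).
  by rewrite ler_pM2l // sum_texcess.
lra.
Qed.

Definition linkmono x y := \sum_u ind x u * ind y u * mono_count R x y u.

Lemma tri_linkmono : tri (fun x y _ => linkmono x y) <= b * tri (@mono_count R G).
Proof.
by apply: (tri_exchange cod_le (F := @mono_count R G)) => x y z *; apply: mono_count_ge0.
Qed.

Lemma linkmono_ge0 x y : 0 <= linkmono x y.
Proof. by apply: sumr_ge0 => u _; rewrite !mulr_ge0 ?adjR_ge0 ?mono_count_ge0. Qed.

(** If [F > K] on every triangle, the sum of [F - K] could be nonpositive only without triangles. *)
Lemma exists_tri (F : G -> G -> G -> R) K : tri F <= K * tau ->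
  exists x y z, [/\ adj x y, adj x z, adj y z & F x y z <= K].
Proof.
move=> le.
have [/existsP[x /existsP[y /existsP[z /and4P[xy xz yz FK]]]]|nex] :=
  boolP [exists x : G, exists y : G, exists z : G,
    [&& adj x y, adj x z, adj y z & F x y z <= K]]; first by exists x, y, z.
have gtK x y z : adj x y -> adj x z -> adj y z -> K < F x y z.
  move=> xy xz yz; rewrite ltNge; apply: contra nex => FK.
  by apply/existsP; exists x; apply/existsP; exists y; apply/existsP; exists z; apply/and4P.
have terms0 x y z : 0 <= ind x y * (ind x z * ind y z) * (F x y z - K).
  rewrite /adjR; case: (boolP (adj x y)) => [xy|]; last by rewrite !mul0r.
  case: (boolP (adj x z)) => [xz|]; last by rewrite mul0r mulr0 mul0r.
  case: (boolP (adj y z)) => [yz|]; last by rewrite !mulr0 mul0r.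
  by rewrite !mul1r subr_ge0 ltW ?gtK.
have tri0 : tri (fun x y z => F x y z - K) = 0.
  apply/eqP; rewrite eq_le triD (tri_cst G (- K)).
  rewrite mulNr subr_le0 le /= -mulNr -tri_cst -triD.
  by do 3![apply: sumr_ge0 => ? _].
have : tau = 0; last by move=> t0; move: tau_gt0; rewrite t0 ltxx.
apply: big1 => x _; apply: big1 => y _; apply: big1 => z _; rewrite mulr1.
have t0 : ind x y * (ind x z * ind y z) * (F x y z - K) = 0.
  have s1 : \sum_y \sum_z ind x y * (ind x z * ind y z) * (F x y z - K) = 0.
    by apply: (psumr_eq0P _ tri0) => // ? _; do 2![apply: sumr_ge0 => ? _].
  have s2 : \sum_z ind x y * (ind x z * ind y z) * (F x y z - K) = 0.
    by apply: (psumr_eq0P _ s1) => // ? _; apply: sumr_ge0 => ? _.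
  exact: (psumr_eq0P _ s2).
move: t0; rewrite /adjR; case: (boolP (adj x y)) => [xy|_]; last by rewrite !mul0r.
case: (boolP (adj x z)) => [xz|_]; last by rewrite mul0r mulr0.
case: (boolP (adj y z)) => [yz|_]; last by rewrite !mulr0.
by rewrite !mul1r => /eqP; rewrite subr_eq0 gt_eqF ?gtK.
Qed.

(** All quantities that have to be small for the classes traced by [xyz] to be nearly a
blow-up of the prism. *)
Definition badness x y z :=
  b * mono_count R x y z + b * (gap x y + gap x z + gap y z)
  + (linkmono x y + linkmono x z + linkmono y z)
  + (linkgap x y + linkgap y x + linkgap x z + linkgap z x + linkgap y z + linkgap z y)
  + (texcess x + texcess y + texcess z) / (6 * b).

(** The constant is three times 361, for the excesses at the three vertices, and some
units for the other terms. *)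
Lemma tri_badness : tri badness <= 1100 * mu * b ^+ 2 * tau.
Proof.
have [_ g1 _ g2 _] := tri_perm gap.
have [_ m1 _ m2 _] := tri_perm linkmono.
have [l1 l2 l3 l4 l5] := tri_perm linkgap.
have t1 : tri (fun x y z => texcess y / (6 * b)) = tri (fun x y z => texcess x / (6 * b)).
  by rewrite tri_swap.
have t2 : tri (fun x y z => texcess z / (6 * b)) = tri (fun x y z => texcess x / (6 * b)).
  by rewrite tri_rot t1.
have -> : tri badness = b * tri (@mono_count R G) + b * (3 * tri (fun x y _ => gap x y))
   + 3 * tri (fun x y _ => linkmono x y) + 6 * tri (fun x y _ => linkgap x y)
   + 3 * tri (fun x _ _ => texcess x / (6 * b)).
  transitivity (b * tri (@mono_count R G) + b * (tri (fun x y _ => gap x y) +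
     tri (fun x y z => gap x z) + tri (fun x y z => gap y z))
   + (tri (fun x y _ => linkmono x y) + tri (fun x y z => linkmono x z) + tri (fun x y z => linkmono y z))
   + (tri (fun x y _ => linkgap x y) + tri (fun x y z => linkgap y x) + tri (fun x y z => linkgap x z) +
      tri (fun x y z => linkgap z x) + tri (fun x y z => linkgap y z) + tri (fun x y z => linkgap z y))
   + (tri (fun x _ _ => texcess x / (6 * b)) + tri (fun x y _ => texcess y / (6 * b)) + tri (fun x y z => texcess z / (6 * b)))).
    rewrite -!triD -!triZ -!triD; apply: eq_tri => x y z.
    by rewrite /badness; ring.
  rewrite g1 g2 m1 m2 l1 l2 l3 l4 l5 t1 t2; ring.
have h1 := tri_mono_count_le cod_le surplus0 b_gt0.
have h2 := tri_gap_le cod_le surplus0 b_gt0.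
have h3 := tri_linkmono; have h4 := tri_linkgap cod_le.
have h5 := tri_texcess.
have s4 : mu ^+ 2 * b * tau <= mu * b * tau.
  rewrite -!(mulrA _ b) ler_wpM2r //; first by rewrite mulr_ge0 // ltW.
  by move: mu2 mu_gt0; lra.
have k1 : b * (2 * tri (@mono_count R G)) <= b * (mu * b * tau) by rewrite ler_pM2l //; move: defect_tau; lra.
have k2 : b * (3 * tri (fun x y _ => gap x y)) <= b * (mu * b * tau) by rewrite ler_pM2l //; move: defect_tau; lra.
have : 0 <= mu * b ^+ 2 * tau by rewrite !mulr_ge0 ?sqr_ge0 ?ltW.
lra.
Qed.

Let K := 1100 * mu * b ^+ 2.

Lemma good_triangle : exists x y z,
  [/\ adj x y, adj x z, adj y z & [/\ b * mono_count R x y z <= K,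
   [/\ b * gap x y <= K, b * gap x z <= K & b * gap y z <= K],
   [/\ linkmono x y <= K, linkmono x z <= K & linkmono y z <= K],
   [/\ linkgap x y <= K, linkgap y x <= K, linkgap x z <= K, linkgap z x <= K
      & linkgap y z <= K /\ linkgap z y <= K] &
   [/\ tdeg x <= 2 * b ^+ 2 + K, tdeg y <= 2 * b ^+ 2 + K & tdeg z <= 2 * b ^+ 2 + K]]].
Proof.
have [x [y [z [xy xz yz bad]]]] := exists_tri tri_badness.
exists x, y, z; split=> //.
have m0 : 0 <= b * mono_count R x y z by rewrite mulr_ge0 ?mono_count_ge0.
have g0 u v : adj u v -> 0 <= b * gap u v by move=> uv; rewrite mulr_ge0 ?(gap_ge0 cod_le).
have gxy := g0 _ _ xy; have gxz := g0 _ _ xz; have gyz := g0 _ _ yz.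
have lm := linkmono_ge0; have lg := linkgap_ge0 cod_le.
have l1 := lm x y; have l2 := lm x z; have l3 := lm y z.
have l4 := lg x y; have l5 := lg y x; have l6 := lg x z; have l7 := lg z x.
have l8 := lg y z; have l9 := lg z y.
have t0 v : 0 <= texcess v / (6 * b) by rewrite divr_ge0 ?texcess_ge0 // mulr_ge0.
have tx := t0 x; have ty := t0 y; have tz := t0 z.
have := tdeg_texcess x; have := tdeg_texcess y; have := tdeg_texcess z.
move: bad; rewrite /badness /K {g0 lm lg t0} => bad dz dy dx.
by do !split; lra.
Qed.

End GoodTriangle.

(** * Colourings by the vertices of the prism *)

Definition i0 : 'I_3 := @Ordinal 3 0 isT.
Definition i1 : 'I_3 := @Ordinal 3 1 isT.
Definition i2 : 'I_3 := @Ordinal 3 2 isT.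

Lemma ord3P (i : 'I_3) : [\/ i = i0, i = i1 | i = i2].
Proof.
by case: i => [[|[|[|//]]] lti]; [constructor 1|constructor 2|constructor 3]; apply: val_inj.
Qed.

Lemma sum_ord3 (V : zmodType) (F : 'I_3 -> V) : \sum_i F i = F i0 + F i1 + F i2.
Proof.
rewrite !big_ord_recl big_ord0 addr0 addrA; congr (F _ + F _ + F _); exact: val_inj.
Qed.

Lemma sum_prism (V : zmodType) (F : prism -> V) :
  \sum_c F c = F (false, i0) + F (false, i1) + F (false, i2) +
    (F (true, i0) + F (true, i1) + F (true, i2)).
Proof.
transitivity (\sum_s \sum_i F (s, i)).
  by rewrite pair_bigA; apply: eq_bigr => -[s i].
rewrite big_bool !sum_ord3 /= addrC //.
Qed.

Lemma sum_option (V : zmodType) (T : finType) (F : option T -> V) :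
  \sum_o F o = F None + \sum_c F (Some c).
Proof.
rewrite (bigD1 None) //=; congr (_ + _).
rewrite (reindex_omap Some id) => [|[c|] //]; apply: eq_bigl => c /=.
by rewrite eqxx.
Qed.

(** Uncoloured vertices ([None]) are adjacent to nothing in the pattern. *)
Definition oadj (o1 o2 : option prism) : bool :=
  if o1 is Some c then if o2 is Some d then adj c d else false else false.

Lemma oadjC o1 o2 : oadj o1 o2 = oadj o2 o1.
Proof. by case: o1 o2 => [c|] [d|] //=; apply: prism_adj_sym. Qed.

Section Colouring.
Variables (R : realFieldType) (G : sgraph) (cls : G -> option prism).
Implicit Types (u v w : G).
Local Notation ind := (@adjR R G).

Definition class_size (o : option prism) : R := #|[set v | cls v == o]|%:R.

Lemma class_size_sum o : class_size o = \sum_v (cls v == o)%:R.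
Proof.
by rewrite /class_size -sum1dep_card natr_sum big_mkcond; apply: eq_bigr => v _; case: eqP.
Qed.

Lemma class_size_ge0 o : 0 <= class_size o. Proof. exact: ler0n. Qed.

Lemma sum_cls (f : option prism -> R) :
  \sum_v f (cls v) = class_size None * f None + \sum_c class_size (Some c) * f (Some c).
Proof.
rewrite -(sum_option (fun o => class_size o * f o)).
under [RHS]eq_bigr => o _ do rewrite class_size_sum mulr_suml.
rewrite exchange_big; apply: eq_bigr => v _ /=.
rewrite (bigD1 (cls v)) //= eqxx mul1r big1 ?addr0 // => o.
by rewrite eq_sym => /negPf->; rewrite mul0r.
Qed.

(** The indicator that the colours of [v] and [w] are adjacent in the prism. *)
Definition pattern v w : R := (oadj (cls v) (cls w))%:R.
(** The indicator of a pair that an exact blow-up of the prism would join but [G] does not. *)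
Definition missing v w : R := pattern v w * (1 - ind v w).

Local Notation p i := (class_size (Some (false, i))).
Local Notation q i := (class_size (Some (true, i))).

Lemma sum_class_size : #|G|%:R =
   class_size None + (p i0 + p i1 + p i2) + (q i0 + q i1 + q i2).
Proof.
rewrite -sum1G (sum_cls (fun=> 1)) sum_prism; ring.
Qed.

Lemma sum_pattern : \sum_v \sum_w pattern v w =
  2 * (p i0 * p i1 + p i0 * p i2 + p i1 * p i2 +
       (q i0 * q i1 + q i0 * q i2 + q i1 * q i2) +
       (p i0 * q i0 + p i1 * q i1 + p i2 * q i2)).
Proof.
rewrite (sum_cls (fun o => \sum_w (oadj o (cls w))%:R)).
have sumw o : \sum_w (oadj o (cls w))%:R = _ :=
  sum_cls (fun o' => (oadj o o')%:R).
rewrite sum_prism !sumw !sum_prism /=.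
rewrite /prism_adj /=; ring.
Qed.

(** Twice the number of adjacent pairs in the complete blow-up, as a quadratic form in
the sizes of the parts: the square of the number of vertices, corrected by a form
in the differences between opposite parts. *)
Lemma sum_pattern_quad : 2 * \sum_v \sum_w pattern v w =
  (p i0 + p i1 + p i2 + (q i0 + q i1 + q i2)) ^+ 2
  + (p i0 + p i1 + p i2 - (q i0 + q i1 + q i2)) ^+ 2
  - 2 * ((p i0 - q i0) ^+ 2 + (p i1 - q i1) ^+ 2 + (p i2 - q i2) ^+ 2).
Proof. rewrite sum_pattern; ring. Qed.

Lemma pattern_ge0 v w : 0 <= pattern v w. Proof. exact: ler0n. Qed.
Lemma missing_ge0 v w : 0 <= missing v w.
Proof. by rewrite mulr_ge0 ?pattern_ge0 ?adjR_compl_ge0. Qed.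

Lemma patternC v w : pattern v w = pattern w v.
Proof. by rewrite /pattern oadjC. Qed.
Lemma missingC v w : missing v w = missing w v.
Proof. by rewrite /missing patternC adjRC. Qed.

End Colouring.

(** * The classes traced on a triangle *)

(** A vertex adjacent to exactly one vertex of the triangle gets the class of the
second triangle of the prism with that index; a vertex adjacent to exactly two
is a twin of the third one. *)
Definition trace_class (p q r : bool) : option prism :=
  match p, q, r with
  | false, true, true => Some (false, i0)
  | true, false, true => Some (false, i1)
  | true, true, false => Some (false, i2)
  | true, false, false => Some (true, i0)
  | false, true, false => Some (true, i1)
  | false, false, true => Some (true, i2)
  | _, _, _ => None
  end.

Section NearPrism.
Variables (R : realFieldType) (G : sgraph) (b : R) (x y z : G).
Implicit Types (u v w : G).
Local Notation n := (#|G|%:R : R).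
Local Notation ind := (@adjR R G).
Local Notation cod := (@cod R G).
Local Notation tdeg := (@tdeg R G).
Local Notation gap := (@gap R G b).
Local Notation linkgap := (@linkgap R G b).
Local Notation linkmono := (@linkmono R G).

Hypothesis cod_le : forall x y, adj x y -> cod x y <= b.
Hypothesis b_ge0 : 0 <= b.

Definition trace_cls v := trace_class (adj x v) (adj y v) (adj z v).
Local Notation csize := (@class_size R G trace_cls).

Definition all3 v : R := ind x v * ind y v * ind z v.
(** The indicator of an edge that contradicts the prism. *)
Definition bad v w : R :=
  ((trace_cls v != None) && (trace_cls w != None) && ~~ oadj (trace_cls v) (trace_cls w))%:R * ind v w.

Lemma trace_size_None : csize None = mono_count R x y z.
Proof.
rewrite class_size_sum; apply: eq_bigr => v _; rewrite /mono !(adjRC R v) /trace_cls /adjR.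
by case: (adj x v) (adj y v) (adj z v) => [] [] [] /=; ring.
Qed.

Lemma all3_ge0 v : 0 <= all3 v.
Proof. by rewrite !mulr_ge0 ?adjR_ge0. Qed.

Lemma sum_all3 : \sum_v all3 v <= mono_count R x y z.
Proof.
apply: ler_sum => v _; rewrite /mono !(adjRC R v) /all3 lerDl.
by rewrite !mulr_ge0 ?adjR_compl_ge0.
Qed.

Lemma trace_size_U :
  [/\ csize (Some (false, i0)) = cod y z - \sum_v all3 v,
      csize (Some (false, i1)) = cod x z - \sum_v all3 v &
      csize (Some (false, i2)) = cod x y - \sum_v all3 v].
Proof.
by split; rewrite class_size_sum -sumrB; apply: eq_bigr => v _; rewrite /all3 /trace_cls /adjR;
   case: (adj x v) (adj y v) (adj z v) => [] [] [] /=; ring.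
Qed.

(** For adjacent [u] and [v], an edge [sw] inside their common neighbourhood makes the
triangle [uvs] monochromatic for [w]. *)
Lemma sum_link_edges u v :
  \sum_s \sum_w (ind u s * ind v s) * (ind u w * ind v w) * ind s w <= linkmono u v.
Proof.
apply: ler_sum => s _.
have -> : \sum_w (ind u s * ind v s) * (ind u w * ind v w) * ind s w =
  ind u s * ind v s * \sum_w ind u w * ind v w * ind s w.
  by rewrite mulr_sumr; apply: eq_bigr => w _; ring.
rewrite ler_wpM2l ?mulr_ge0 ?adjR_ge0 //; apply: ler_sum => w _.
by rewrite /mono !(adjRC R w) lerDl !mulr_ge0 ?adjR_compl_ge0.
Qed.

(** The vertices adjacent to [u] but not to [v] and [w] account for what the two common
neighbourhoods leave of the triangles at [u]. *)
Lemma sum_private (u v w : G) :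
  \sum_s \sum_r ind u s * (1 - ind v s) * (1 - ind w s) * ind u r * ind s r <=
  tdeg u - (b * cod u v - linkgap u v) - (b * cod u w - linkgap u w)
  + b * \sum_s ind u s * ind v s * ind w s.
Proof.
rewrite -(linkgap_cod b u v) -(linkgap_cod b u w) tdeg_cod mulr_sumr -!sumrB -big_split /=.
apply: ler_sum => s _.
have -> : \sum_r ind u s * (1 - ind v s) * (1 - ind w s) * ind u r * ind s r =
  ind u s * (1 - ind v s) * (1 - ind w s) * cod u s.
  by rewrite mulr_sumr; apply: eq_bigr => r _; ring.
have [us|us] := boolP (adj u s); last first.
  have -> : ind u s = 0 by rewrite /adjR (negPf us).
  by rewrite !mul0r; lra.
have -> : ind u s = 1 by rewrite /adjR us.
have : 0 <= ind v s * ind w s * (b - cod u s).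
  by rewrite !mulr_ge0 ?adjR_ge0 // subr_ge0 cod_le.
lra.
Qed.

Local Notation priv u v w s r := (ind u s * (1 - ind v s) * (1 - ind w s) * ind u r * ind s r).
Local Notation link u v s r := ((ind u s * ind v s) * (ind u r * ind v r) * ind s r).

(** An edge contradicting the prism either joins two twins of the same vertex of the triangle,
or joins a vertex seen by a single vertex of the triangle to another neighbour
of that vertex. *)
Lemma bad_le s r : bad s r <=
  link x y s r + link x z s r + link y z s r +
  (priv x y z s r + priv x y z r s) + (priv y x z s r + priv y x z r s) +
  (priv z x y s r + priv z x y r s).
Proof.
rewrite /bad /trace_cls (adjRC R r s).
have : 0 <= ind s r := adjR_ge0 R s r.
move: (ind s r) => a; rewrite /adjR => a0.
case: (adj x s) (adj y s) (adj z s) (adj x r) (adj y r) (adj z r) => [] [] [] [] [] [];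
  rewrite /= /prism_adj /= ?subrr ?subr0 ?mul0r ?mul1r ?mulr0 ?mulr1 ?mul0r ?addr0 ?add0r ?lexx //; lra.
Qed.

Lemma exch2 (f : G -> G -> R) : \sum_s \sum_r f r s = \sum_s \sum_r f s r.
Proof. exact: exchange_big. Qed.

Lemma sum_bad : \sum_s \sum_r bad s r <=
  linkmono x y + linkmono x z + linkmono y z +
  2 * (tdeg x + tdeg y + tdeg z - 2 * b * (cod x y + cod x z + cod y z)
  + (linkgap x y + linkgap x z + linkgap y x + linkgap y z + linkgap z x + linkgap z y)
  + 3 * b * mono_count R x y z).
Proof.
apply: le_trans (_ : \sum_s \sum_r (link x y s r + link x z s r + link y z s r +
  (priv x y z s r + priv x y z r s) + (priv y x z s r + priv y x z r s) +
  (priv z x y s r + priv z x y r s)) <= _).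
  by apply: ler_sum => s _; apply: ler_sum => r _; apply: bad_le.
have -> : \sum_s \sum_r (link x y s r + link x z s r + link y z s r +
  (priv x y z s r + priv x y z r s) + (priv y x z s r + priv y x z r s) +
  (priv z x y s r + priv z x y r s)) =
  (\sum_s \sum_r link x y s r) + (\sum_s \sum_r link x z s r) + (\sum_s \sum_r link y z s r)
  + 2 * (\sum_s \sum_r priv x y z s r) + 2 * (\sum_s \sum_r priv y x z s r)
  + 2 * (\sum_s \sum_r priv z x y s r).
  rewrite !(mulr2n, mulrDl, mul1r) -{2}(exch2 (fun s r => priv x y z s r)).
  rewrite -{2}(exch2 (fun s r => priv y x z s r)) -{2}(exch2 (fun s r => priv z x y s r)).
  rewrite -!big_split; apply: eq_bigr => s _; rewrite -!big_split /=.
  by apply: eq_bigr => r _; ring.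
have l1 := sum_link_edges x y; have l2 := sum_link_edges x z; have l3 := sum_link_edges y z.
have p1 := sum_private x y z; have p2 := sum_private y x z; have p3 := sum_private z x y.
have e1 : \sum_s ind y s * ind x s * ind z s = \sum_s all3 s.
  by apply: eq_bigr => s _; rewrite /all3; ring.
have e2 : \sum_s ind z s * ind x s * ind y s = \sum_s all3 s.
  by apply: eq_bigr => s _; rewrite /all3; ring.
have m : b * \sum_s all3 s <= b * mono_count R x y z by rewrite ler_wpM2l ?sum_all3.
move: p1 p2 p3; rewrite e1 e2 -/(\sum_s all3 s) (codC R y x) (codC R z x) (codC R z y); lra.
Qed.

End NearPrism.

(** * Almost all edges follow the prism *)

Lemma sum_deg_colouring (R : realFieldType) (G : sgraph) (x y z : G) (cls := trace_cls x y z) :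
  \sum_(v : G) deg R v <= \sum_v \sum_w pattern R cls v w - \sum_v \sum_w missing R cls v w
    + \sum_v \sum_w bad R x y z v w + 2 * #|G|%:R * class_size R cls None.
Proof.
have -> : 2 * #|G|%:R * class_size R cls None =
  \sum_(v : G) \sum_(w : G) (cls v == None)%:R + \sum_(v : G) \sum_(w : G) (cls w == None)%:R.
  have E : \sum_(v : G) \sum_(w : G) ((cls v == None)%:R : R) = #|G|%:R * class_size R cls None.
    by rewrite class_size_sum mulr_sumr; apply: eq_bigr => v _; rewrite sum_cst.
  rewrite E [X in _ = _ + X]exchange_big E; ring.
rewrite -sumrB -!big_split /=; apply: ler_sum => v _.
rewrite -sumrB -!big_split /=; apply: ler_sum => w _.
rewrite /missing /bad /pattern -/cls.
have := adjR_ge0 R v w; have := adjR_le1 R v w; move: (adjR R v w) => a.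
case: (cls v) => [c|]; case: (cls w) => [d|] //=; rewrite ?eqxx; try lra.
by case: prism_adj => /=; lra.
Qed.

Lemma sqr_le_abs (R : realFieldType) (a c : R) : 0 <= c -> a ^+ 2 <= c ^+ 2 -> - c <= a <= c.
Proof.
move=> c0; rewrite -[a ^+ 2]real_normK ?num_real // ler_pXn2r ?nnegrE // ler_norml.
by [].
Qed.

(** The first three classes have size about [b] by the choice of the triangle; the
sizes of the others and the number of missing pairs are then forced by the
number of edges, since the quadratic form loses the squares of the differences
[p_i - q_i]. *)
Lemma near_prism_sizes (R : realFieldType) (b k nu n o j p0 p1 p2 q0 q1 q2 M P2 D : R) :
  1 <= b -> 0 <= k -> 144 * k <= 1 -> 0 <= nu -> 52 * k <= nu ^+ 2 -> 2 * k <= nu ->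
  n <= 6 * b -> 6 * b - n <= k * b -> o <= 6 * b - n ->
  0 <= j <= k * b -> 0 <= M ->
  b - 2 * (k * b) <= p0 <= b -> b - 2 * (k * b) <= p1 <= b -> b - 2 * (k * b) <= p2 <= b ->
  n = j + (p0 + p1 + p2) + (q0 + q1 + q2) ->
  2 * P2 = (p0 + p1 + p2 + (q0 + q1 + q2)) ^+ 2 + (p0 + p1 + p2 - (q0 + q1 + q2)) ^+ 2
    - 2 * ((p0 - q0) ^+ 2 + (p1 - q1) ^+ 2 + (p2 - q2) ^+ 2) ->
  - o <= 2 * D - n * n ->
  D <= P2 - M + 39 * k * b ^+ 2 + 2 * n * j ->
  [/\ (p0 - q0) ^+ 2 <= (nu * b) ^+ 2, (p1 - q1) ^+ 2 <= (nu * b) ^+ 2,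
      (p2 - q2) ^+ 2 <= (nu * b) ^+ 2 & M <= (nu * b) ^+ 2].
Proof.
move=> b1 k0 k144 nu0 k52 k2 n6 defect oddn /andP[j0 jk] M0.
move=> /andP[p0l p0u] /andP[p1l p1u] /andP[p2l p2u] nE quad edge total.
have b0 : 0 < b by lra.
have kb : 0 <= k * b by rewrite mulr_ge0 // ltW.
have kb1 : 144 * k * b <= 1 * b by rewrite ler_wpM2r // ltW.
have bb : k * b <= k * b ^+ 2.
  by have := ler_wpM2l kb b1; lra.
have pq : (p0 + p1 + p2 - (q0 + q1 + q2)) ^+ 2 <= k * b ^+ 2.
  have e1 : 0 <= 12 * (k * b) + (p0 + p1 + p2 - (q0 + q1 + q2)).
    by clear -p0l p1l p2l nE j0 n6 kb; lra.
  have e2 : 0 <= 12 * (k * b) - (p0 + p1 + p2 - (q0 + q1 + q2)).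
    by clear -p0u p1u p2u nE jk defect kb; lra.
  have := mulr_ge0 e1 e2.
  have : 144 * k * (k * b ^+ 2) <= 1 * (k * b ^+ 2).
    by rewrite ler_wpM2r // mulr_ge0 // sqr_ge0.
  by clear; lra.
have nj : n * j <= 6 * b * (k * b).
  by apply: ler_pM => //; clear -defect kb1 kb; lra.
have sq : (p0 + p1 + p2 + (q0 + q1 + q2)) ^+ 2 <= n * n.
  have -> : p0 + p1 + p2 + (q0 + q1 + q2) = n - j by rewrite nE; ring.
  have : 0 <= j * (2 * n - j).
    by rewrite mulr_ge0 //; clear -defect kb1 kb jk; lra.
  by clear; lra.
have nub : 52 * k * b ^+ 2 <= nu ^+ 2 * b ^+ 2 by rewrite ler_wpM2r // sqr_ge0.
have := sqr_ge0 (p0 - q0); have := sqr_ge0 (p1 - q1); have := sqr_ge0 (p2 - q2).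
rewrite exprMn; move: total quad edge sq nj nub pq bb M0 oddn defect.
move: ((p0 - q0) ^+ 2) ((p1 - q1) ^+ 2) ((p2 - q2) ^+ 2) (nu ^+ 2 * b ^+ 2) => d0 d1 d2 N.
move: ((p0 + p1 + p2 - (q0 + q1 + q2)) ^+ 2) ((p0 + p1 + p2 + (q0 + q1 + q2)) ^+ 2) => PQ SQ.
clear -b0; move=> *; split; lra.
Qed.

Lemma near_prism_colouring (R : realFieldType) (G : sgraph) (b k nu : R) (x y z : G)
    (cls := trace_cls x y z) :
  (#|G| ^ 2 %/ 4 <= #|edges G|)%N ->
  (forall u v : G, adj u v -> cod R u v <= b) ->
  1 <= b -> 0 <= k -> 144 * k <= 1 -> 0 <= nu -> 52 * k <= nu ^+ 2 -> 2 * k <= nu ->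
  #|G|%:R <= 6 * b -> 6 * b - #|G|%:R <= k * b -> (odd #|G|)%:R <= 6 * b - #|G|%:R ->
  [/\ adj x y, adj x z, adj y z & [/\ b * mono_count R x y z <= k * b ^+ 2,
   [/\ b * gap b x y <= k * b ^+ 2, b * gap b x z <= k * b ^+ 2 & b * gap b y z <= k * b ^+ 2],
   [/\ linkmono R x y <= k * b ^+ 2, linkmono R x z <= k * b ^+ 2 & linkmono R y z <= k * b ^+ 2],
   [/\ linkgap b x y <= k * b ^+ 2, linkgap b y x <= k * b ^+ 2, linkgap b x z <= k * b ^+ 2,
       linkgap b z x <= k * b ^+ 2 & linkgap b y z <= k * b ^+ 2 /\ linkgap b z y <= k * b ^+ 2] &
   [/\ tdeg R x <= 2 * b ^+ 2 + k * b ^+ 2, tdeg R y <= 2 * b ^+ 2 + k * b ^+ 2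
      & tdeg R z <= 2 * b ^+ 2 + k * b ^+ 2]]] ->
  [/\ class_size R cls None <= nu * b,
      forall c, (1 - 2 * nu) * b <= class_size R cls (Some c) <= (1 + 2 * nu) * b &
      \sum_v \sum_w missing R cls v w <= nu ^+ 2 * b ^+ 2].
Proof.
move=> dense cod_le b1 k0 k144 nu0 k52 k2 n6 defect oddn.
move=> [xy xz yz [hm [g1 g2 g3] [m1 m2 m3] [l1 l2 l3 l4 [l5 l6]] [t1 t2 t3]]].
have b0 : 0 < b by lra.
have bb : b <= b ^+ 2 by have := ler_wpM2l (ltW b0) b1; lra.
have unb (a : R) : b * a <= k * b ^+ 2 -> a <= k * b.
  by move=> h; rewrite -(ler_pM2l b0); lra.
have {hm}hm := unb _ hm; have {g1}g1 := unb _ g1.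
have {g2}g2 := unb _ g2; have {g3}g3 := unb _ g3.
have c1 := cod_le _ _ xy; have c2 := cod_le _ _ xz; have c3 := cod_le _ _ yz.
rewrite /gap in g1 g2 g3.
have a3 := sum_all3 R x y z.
have a30 : 0 <= \sum_v all3 R x y z v by apply: sumr_ge0 => v _; apply: all3_ge0.
(* [3 k] for the three common neighbourhoods, and twice [3 * 6 k] for the edges
   at the vertices seen by only one of [x, y, z]. *)
have badE : \sum_s \sum_r bad R x y z s r <= 39 * k * b ^+ 2.
  have := sum_bad x y z cod_le (ltW b0).
  have : b * mono_count R x y z <= b * (k * b) by rewrite ler_pM2l.
  have : b * (3 * b - 3 * (k * b)) <= b * (cod R x y + cod R x z + cod R y z).
    by rewrite ler_pM2l //; clear -g1 g2 g3; lra.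
  by clear -m1 m2 m3 l1 l2 l3 l4 l5 l6 t1 t2 t3; lra.
have cN : class_size R cls None = mono_count R x y z := trace_size_None R x y z.
have cN0 := class_size_ge0 R cls None.
have [u0 u1 u2] := trace_size_U R x y z; rewrite -/cls in u0 u1 u2.
have total := @sum_deg_colouring R G x y z; rewrite -/cls in total.
have quad := sum_pattern_quad R cls.
have sizes := sum_class_size R cls.
have edge := sum_dev R dense.
rewrite /dev sumrB -mulr_sumr sum_cst in edge.
have M0 : 0 <= \sum_v \sum_w missing R cls v w.
  by do 2![apply: sumr_ge0 => ? _]; apply: missing_ge0.
have [|||||d0 d1 d2 M] := near_prism_sizes b1 k0 k144 nu0 k52 k2 n6 defect oddn _ M0 _ _ _ sizes quad edge.
- by rewrite cN0 cN hm.
- by rewrite u0; clear -c3 g3 a3 a30 hm; lra.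
- by rewrite u1; clear -c2 g2 a3 a30 hm; lra.
- by rewrite u2; clear -c1 g1 a3 a30 hm; lra.
- by apply: le_trans total _; rewrite lerD2r lerD2l.
have nb : 0 <= nu * b by rewrite mulr_ge0 // ltW.
have kn : 2 * k * b <= nu * b by rewrite ler_wpM2r // ltW.
have {d0}/andP[d0 d0'] := sqr_le_abs nb d0.
have {d1}/andP[d1 d1'] := sqr_le_abs nb d1.
have {d2}/andP[d2 d2'] := sqr_le_abs nb d2.
rewrite -exprMn; split=> //.
  rewrite cN; apply: le_trans hm _.
  by rewrite ler_wpM2r ?(ltW b0) //; clear -k0 k2; lra.
clear total quad sizes edge M M0 badE.
case=> [[] i]; case: (ord3P i) => ->; apply/andP; split;
 clear -u0 u1 u2 d0 d0' d1 d1' d2 d2' c1 c2 c3 g1 g2 g3 a3 a30 hm kn nb; lra.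
Qed.

(** * Combinatorics of the prism *)

Lemma prism_case (P : prism -> Prop) :
  P (false, i0) -> P (false, i1) -> P (false, i2) ->
  P (true, i0) -> P (true, i1) -> P (true, i2) -> forall c, P c.
Proof. by move=> ? ? ? ? ? ? [[] i]; case: (ord3P i) => ->. Qed.

(** The weights [K] describe the neighbourhood of a vertex: no class carries more than
[C], and a neighbour in the class [c] sees nearly everything in the classes adjacent
to [c], so these carry at most [C] together.  If the support is not contained in the
neighbourhood of one class, the constraints of the classes met add up to the bound on
the total weight; this is verified on each of the supports. *)
Lemma prism_fractional (R : realFieldType) (K : prism -> R) (C : R) :
  0 <= C -> (forall c, 0 <= K c <= C) ->
  (forall c, 0 < K c -> \sum_d (adj c d)%:R * K d <= C) ->
  \sum_c K c <= 2 * C \/ exists c, forall d, 0 < K d -> adj c d.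
Proof.
move=> C0 K0 KC; rewrite sum_prism.
have := KC (true, i2); have := KC (true, i1); have := KC (true, i0).
have := KC (false, i2); have := KC (false, i1); have := KC (false, i0).
rewrite !sum_prism /= /prism_adj /= !mul0r !mul1r !addr0 !add0r.
have posE c : 0 < K c \/ K c = 0.
  by have /andP[+ _] := K0 c; rewrite le_eqVlt => /orP[/eqP <-|]; [right|left].
have leE c : K c <= C by case/andP: (K0 c).
move: (leE (false, i0)) (leE (false, i1)) (leE (false, i2)) (leE (true, i0)) (leE (true, i1)) (leE (true, i2)).
suff finish : [\/ K (false, i0) = 0 /\ K (true, i1) = 0 /\ K (true, i2) = 0,
    K (false, i1) = 0 /\ K (true, i0) = 0 /\ K (true, i2) = 0 |
    K (false, i2) = 0 /\ K (true, i0) = 0 /\ K (true, i1) = 0] \/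
    [\/ K (true, i0) = 0 /\ K (false, i1) = 0 /\ K (false, i2) = 0,
    K (true, i1) = 0 /\ K (false, i0) = 0 /\ K (false, i2) = 0 |
    K (true, i2) = 0 /\ K (false, i0) = 0 /\ K (false, i1) = 0] ->
    exists c, forall d, 0 < K d -> adj c d.
  move: finish (posE (true, i2)) (posE (true, i1)) (posE (true, i0))
   (posE (false, i2)) (posE (false, i1)) (posE (false, i0)).
  move: (K (true, i2)) (K (true, i1)) (K (true, i0)) (K (false, i2)) (K (false, i1)) (K (false, i0)).
  move=> c2 c1 c0 a2 a1 a0; move: (exists c, _) => Q.
  clear -C0 => Qi [c2p|?] [c1p|?] [c0p|?] [a2p|?] [a1p|?] [a0p|?]; subst => b0 b1 b2 b3 b4 b5 h0 h1 h2 h3 h4 h5;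
  first [ by right; apply: Qi; left; constructor 1
        | by right; apply: Qi; left; constructor 2
        | by right; apply: Qi; left; constructor 3
        | by right; apply: Qi; right; constructor 1
        | by right; apply: Qi; right; constructor 2
        | by right; apply: Qi; right; constructor 3
        | left; clear Qi; try move: (h0 ltac:(assumption)); clear h0;
          try move: (h1 ltac:(assumption)); clear h1;
          try move: (h2 ltac:(assumption)); clear h2;
          try move: (h3 ltac:(assumption)); clear h3;
          try move: (h4 ltac:(assumption)); clear h4;
          try move: (h5 ltac:(assumption)); clear h5; lra ].
move=> [[]|[]] [e1 [e2 e3]];
[exists (false, i0)|exists (false, i1)|exists (false, i2)
|exists (true, i0)|exists (true, i1)|exists (true, i2)];
by apply: prism_case; rewrite ?e1 ?e2 ?e3 ?ltxx.
Qed.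

(** Two classes that are not adjacent share at least two of their three neighbouring
classes, so two vertices of large degree following these classes have many common neighbours. *)
Lemma prism_common (R : realFieldType) (c c' : prism) (F H : prism -> R) S :
  (forall d, 0 <= F d <= S) -> (forall d, 0 <= H d <= S) -> ~~ adj c c' ->
  \sum_d (adj c d)%:R * F d + \sum_d (adj c' d)%:R * H d - 4 * S <=
  \sum_d (adj c d && adj c' d)%:R * (F d + H d - S).
Proof.
move=> F0 H0.
have /andP[]:= F0 (false, i0); have /andP[]:= F0 (false, i1); have /andP[]:= F0 (false, i2).
have /andP[]:= F0 (true, i0); have /andP[]:= F0 (true, i1); have /andP[]:= F0 (true, i2).
have /andP[]:= H0 (false, i0); have /andP[]:= H0 (false, i1); have /andP[]:= H0 (false, i2).
have /andP[]:= H0 (true, i0); have /andP[]:= H0 (true, i1); have /andP[]:= H0 (true, i2).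
rewrite !sum_prism; clear; do 24!move=> ?.
move: c c'; apply: prism_case; apply: prism_case; rewrite //= /prism_adj //= => _; lra.
Qed.

Lemma prism_sub (c c' : prism) : (forall d, adj c d -> adj c' d) -> c = c'.
Proof.
move: c c'; apply: prism_case; apply: prism_case => H //;
first [ by have := H (false, i0) isT | by have := H (false, i1) isT
      | by have := H (false, i2) isT | by have := H (true, i0) isT
      | by have := H (true, i1) isT | by have := H (true, i2) isT ].
Qed.

(** * A colouring without bad edges *)

Section CleanColouring.
Variables (R : realFieldType) (G : sgraph) (b nu : R) (cls : G -> option prism).
Implicit Types (u v w : G) (c d : prism).
Local Notation n := (#|G|%:R : R).
Local Notation ind := (@adjR R G).
Local Notation deg := (@deg R G).
Local Notation cod := (@cod R G).
Local Notation csize := (@class_size R G cls).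
Local Notation miss := (@missing R G cls).
Local Notation pat := (@pattern R G cls).

Hypothesis cod_le : forall u v, adj u v -> cod u v <= b.
Hypothesis b_gt0 : 0 < b.
Hypothesis nu_gt0 : 0 < nu.
Hypothesis nu_le : 1000 * nu <= 1.
Hypothesis none_le : csize None <= nu * b.
Hypothesis size_bounds : forall c, (1 - 2 * nu) * b <= csize (Some c) <= (1 + 2 * nu) * b.
Hypothesis miss_le : \sum_v \sum_w miss v w <= nu ^+ 2 * b ^+ 2.

Let nb_gt0 : 0 < nu * b. Proof. by rewrite mulr_gt0. Qed.
Let nb_le : 1000 * (nu * b) <= b.
Proof. by have := ler_wpM2r (ltW b_gt0) nu_le; rewrite mul1r mulrA. Qed.

(** Coloured vertices that miss few of the vertices they should be adjacent to. *)
Definition typ v := (cls v != None) && (\sum_w miss v w <= nu * b).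
Definition in_typ c v : R := (typ v && (cls v == Some c))%:R.
Definition reach v c := \sum_w in_typ c w * ind v w.
Definition tsize c := \sum_w in_typ c w.

Lemma atypical_le : \sum_v (~~ typ v)%:R <= 2 * (nu * b).
Proof.
have : \sum_v (~~ typ v)%:R <= csize None + (\sum_v \sum_w miss v w) / (nu * b).
  rewrite class_size_sum mulr_suml -big_split /=; apply: ler_sum => v _.
  rewrite /typ negb_and negbK.
  have m0 : 0 <= \sum_w miss v w by apply: sumr_ge0 => w _; apply: missing_ge0.
  have q0 : 0 <= (\sum_w miss v w) / (nu * b) by rewrite divr_ge0 // ltW.
  case: eqP => [_|_] /=; first by rewrite lerDl.
  case: (leP (\sum_w miss v w) (nu * b)) => [_|lt] /=; first by move: q0; lra.
  have : 1 <= (\sum_w miss v w) / (nu * b) by rewrite ler_pdivlMr // mul1r ltW.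
  by lra.
move/le_trans; apply.
have : (\sum_v \sum_w miss v w) / (nu * b) <= nu * b.
  by rewrite ler_pdivrMr // -expr2 exprMn.
by move: none_le; lra.
Qed.

Lemma in_typ_ge0 c v : 0 <= in_typ c v. Proof. exact: ler0n. Qed.

Lemma reach_ge0 v c : 0 <= reach v c.
Proof. by apply: sumr_ge0 => w _; rewrite mulr_ge0 ?adjR_ge0 ?in_typ_ge0. Qed.

Lemma tsize_le c : tsize c <= (1 + 2 * nu) * b.
Proof.
have /andP[_ /(le_trans _)-> //] := size_bounds c.
rewrite class_size_sum; apply: ler_sum => v _; rewrite /in_typ ler_nat.
by case: (cls v == _); rewrite ?andbF ?andbT // leq_b1.
Qed.

Lemma tsize_ge c : (1 - 4 * nu) * b <= tsize c.
Proof.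
have /andP[h _] := size_bounds c.
have : csize (Some c) <= tsize c + \sum_v (~~ typ v)%:R.
  rewrite class_size_sum -big_split; apply: ler_sum => v _ /=; rewrite /in_typ.
  by case: typ; case: (cls v == _) => /=; lra.
by move: h atypical_le; lra.
Qed.

Lemma reach_le_tsize v c : reach v c <= tsize c.
Proof. by apply: ler_sum => w _; rewrite ler_piMr ?adjR_le1 ?in_typ_ge0. Qed.

Lemma sum_in_typ w : \sum_c in_typ c w = (typ w)%:R.
Proof.
rewrite /in_typ /typ; case: (cls w) => [d|] /=; last by rewrite big1.
rewrite (bigD1 d) //= eqxx andbT [X in _ + X]big1 ?addr0 // => c cd.
by rewrite (inj_eq Some_inj) eq_sym (negPf cd) andbF.
Qed.

Lemma deg_reach v : deg v <= \sum_c reach v c + 2 * (nu * b).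
Proof.
apply: le_trans (_ : \sum_c reach v c + \sum_w (~~ typ w)%:R <= _); last first.
  by rewrite lerD2l atypical_le.
rewrite exchange_big -big_split; apply: ler_sum => w _ /=.
rewrite -mulr_suml sum_in_typ; have := adjR_le1 R v w.
by case: typ => /=; lra.
Qed.

(** A typical neighbour [u] of [v] is adjacent to nearly all of the classes adjacent to
its own, so [v] has at most slightly more than [b] neighbours there. *)
Lemma reach_pattern u v c : adj v u -> typ u -> cls u = Some c ->
  \sum_d (adj c d)%:R * reach v d <= b + nu * b.
Proof.
move=> vu tu cu; have /andP[_ mu] := tu.
apply: le_trans (_ : cod v u + \sum_w miss u w <= _); last first.
  by rewrite lerD // cod_le.
under eq_bigr => d _ do rewrite mulr_sumr.
rewrite exchange_big -big_split; apply: ler_sum => w _ /=.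
under eq_bigr => d _ do rewrite mulrA.
rewrite -mulr_suml; apply: le_trans (_ : pat u w * ind v w <= _).
  rewrite ler_wpM2r ?adjR_ge0 // /pattern cu /in_typ.
  have [cw|cw] := eqVneq (cls w) None.
    by rewrite big1 ?ler0n // => d _; rewrite cw andbF mulr0.
  case: (cls w) cw => [e|//] _ /=; rewrite (bigD1 e) //= eqxx andbT [X in _ + X]big1 ?addr0.
    by rewrite ler_piMr ?ler0n // lern1 leq_b1.
  by move=> d de; rewrite (inj_eq Some_inj) eq_sym (negPf de) andbF mulr0.
rewrite /adjR /missing /adjR.
have := @pattern_ge0 R G cls u w; have : pat u w <= 1 by rewrite lern1 leq_b1.
by move: (pat u w) => p; case: adj; case: adj => /=; lra.
Qed.

Lemma reach_typ v c : 0 < reach v c ->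
  exists2 u, adj v u & typ u && (cls u == Some c).
Proof.
have [/existsP[u /andP[vu tu]] _|no] :=
  boolP [exists u, adj v u && (typ u && (cls u == Some c))]; first by exists u.
rewrite /reach big1 ?ltxx // => w _; rewrite /in_typ /adjR.
have := forallP (introT forallP (fun w => existsPn no w)) w.
by case: adj => /=; rewrite ?mulr0 // => /negPf->; rewrite mul0r.
Qed.

(** The threshold [13/5 b] lies above the bound [2 b] of [prism_fractional], and it is
large enough for two such vertices with conflicting patterns to have more than [b]
common neighbours; it lies below [3 b] by enough for the loss of edges at the
other vertices to be profitable in the final count. *)
Definition big v := 13 * b < 5 * deg v.

Lemma big_pattern v : big v -> exists c, [forall d, (0 < reach v d) ==> adj c d].
Proof.
move=> bv.
have C0 : 0 <= (1 + 2 * nu) * b.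
  by rewrite mulr_ge0 ?(ltW b_gt0) // addr_ge0 // mulr_ge0 // ltW.
have [||le|[c cP]] := @prism_fractional R (reach v) ((1 + 2 * nu) * b) C0.
- by move=> c; rewrite reach_ge0 (le_trans (reach_le_tsize v c)) ?tsize_le.
- move=> c /reach_typ[u vu /andP[tu /eqP cu]].
  apply: le_trans (reach_pattern vu tu cu) _.
  by move: nb_gt0; lra.
- by have := deg_reach v; move: bv nb_le nb_gt0 b_gt0; rewrite /big; lra.
- by exists c; apply/forallP => d; apply/implyP => /cP.
Qed.

(** The class whose neighbouring classes contain all typical neighbours of a vertex of large degree. *)
Definition clean v : option prism :=
  if big v then [pick c | [forall d, (0 < reach v d) ==> adj c d]] else None.

Lemma clean_None v : clean v = None -> 5 * deg v <= 13 * b.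
Proof.
rewrite /clean; case: ifP => [bv|/negbT]; last by rewrite /big -leNgt.
case: pickP => // noc; have [c cP] := big_pattern bv.
by have := noc c; rewrite cP.
Qed.

Lemma clean_Some v c : clean v = Some c ->
  13 * b < 5 * deg v /\ forall d, 0 < reach v d -> adj c d.
Proof.
rewrite /clean; case: ifP => // bv; case: pickP => // c' /forallP cP [<-].
by split=> // d; apply/implyP.
Qed.

Lemma clean_deg v c : clean v = Some c ->
  13 * b < 5 * (\sum_d (adj c d)%:R * reach v d) + 10 * (nu * b).
Proof.
move=> /clean_Some[bv cP].
have -> : \sum_d (adj c d)%:R * reach v d = \sum_d reach v d.
  apply: eq_bigr => d _; have := reach_ge0 v d; rewrite le_eqVlt.
  by move=> /orP[/eqP<-|/cP->]; rewrite ?mulr0 ?mul1r.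
by have := deg_reach v; lra.
Qed.

(** Otherwise the two vertices would have more than [b] common neighbours, by [prism_common]. *)
Lemma clean_adj v w c c' : clean v = Some c -> clean w = Some c' -> adj v w -> adj c c'.
Proof.
move=> cv cw vw; apply: contraTT (cod_le vw) => ncc; rewrite -ltNge.
have dv := clean_deg cv; have dw := clean_deg cw.
set S := (1 + 2 * nu) * b.
have bnd u d : 0 <= reach u d <= S.
  by rewrite reach_ge0 (le_trans (reach_le_tsize u d)) ?tsize_le.
have cm := prism_common (bnd v) (bnd w) ncc.
have : \sum_d (adj c d && adj c' d)%:R * (reach v d + reach w d - S) <= cod v w.
  apply: le_trans (_ : \sum_d \sum_s in_typ d s * (ind v s * ind w s) <= _).
    apply: ler_sum => d _.
    have pos : 0 <= \sum_s in_typ d s * (ind v s * ind w s).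
      by apply: sumr_ge0 => s _; rewrite !mulr_ge0 ?adjR_ge0 ?in_typ_ge0.
    case: (adj c d && adj c' d); rewrite ?mul0r // mul1r.
    apply: le_trans (_ : reach v d + reach w d - tsize d <= _).
      by rewrite lerD2l lerN2 tsize_le.
    rewrite -big_split -sumrB; apply: ler_sum => s _ /=.
    have : 0 <= in_typ d s * ((1 - ind v s) * (1 - ind w s)).
      by rewrite !mulr_ge0 ?adjR_compl_ge0 ?in_typ_ge0.
    lra.
  rewrite exchange_big; apply: ler_sum => s _ /=; rewrite -mulr_suml sum_in_typ.
  by rewrite ler_piMl ?mulr_ge0 ?adjR_ge0 // lern1 leq_b1.
by move: dv dw cm nb_le nb_gt0 b_gt0; rewrite /S; lra.
Qed.

Lemma clean_typ u c : typ u -> cls u = Some c -> clean u = Some c.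
Proof.
move=> tu cu; have /andP[_ mu] := tu.
have du : 13 * b < 5 * deg u.
  have : \sum_w pat u w - \sum_w miss u w <= deg u.
    rewrite -sumrB; apply: ler_sum => w _; rewrite /missing.
    have -> : pat u w - pat u w * (1 - ind u w) = pat u w * ind u w by ring.
    by rewrite ler_piMl ?adjR_ge0 // lern1 leq_b1.
  have : 3 * ((1 - 2 * nu) * b) <= \sum_w pat u w.
    rewrite /pattern cu (sum_cls cls (fun o => (oadj (Some c) o)%:R)) mulr0 add0r /=.
    have l d : (1 - 2 * nu) * b <= csize (Some d) by case/andP: (size_bounds d).
    rewrite sum_prism; move: c {cu}; apply: prism_case; rewrite /= /prism_adj /=;
    rewrite ?mulr0 ?mulr1 ?addr0 ?add0r;
    have := l (false, i0); have := l (false, i1); have := l (false, i2);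
    have := l (true, i0); have := l (true, i1); have := l (true, i2);
    lra.
  by move: mu nb_le nb_gt0 b_gt0; lra.
case E : (clean u) => [c'|]; last by move: (clean_None E); rewrite leNgt du.
have [_ cP] := clean_Some E; congr Some; apply/esym/prism_sub => d cd.
apply: cP; have : tsize d <= reach u d + \sum_w miss u w.
  rewrite -big_split; apply: ler_sum => w _ /=; rewrite /in_typ /missing /pattern cu.
  case: (typ w); last by rewrite /= mul0r add0r mulr_ge0 ?adjR_compl_ge0 ?ler0n.
  case: eqP => [->|_]; last by rewrite /= mul0r add0r mulr_ge0 ?adjR_compl_ge0 ?ler0n.
  have -> : oadj (Some c) (Some d) = true by exact: cd.
  by rewrite /=; lra.
by have := tsize_ge d; move: mu nb_le nb_gt0 b_gt0; lra.
Qed.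

Lemma clean_size c : (1 - 4 * nu) * b <= class_size R clean (Some c).
Proof.
apply: le_trans (tsize_ge c) _; rewrite class_size_sum; apply: ler_sum => v _.
rewrite /in_typ; case: (boolP (typ v && _)) => [/andP[tv /eqP cv]|_]; last exact: ler0n.
by rewrite (clean_typ tv cv) eqxx.
Qed.

End CleanColouring.

(** * Counting in a colouring without bad edges *)

Section CleanCount.
Variables (R : realFieldType) (G : sgraph) (b : R) (cls : G -> option prism).
Implicit Types (u v w : G) (c d : prism).
Local Notation n := (#|G|%:R : R).
Local Notation ind := (@adjR R G).
Local Notation deg := (@deg R G).
Local Notation cod := (@cod R G).
Local Notation csize := (@class_size R G cls).
Local Notation miss := (@missing R G cls).
Local Notation pat := (@pattern R G cls).

Hypothesis cod_le : forall u v, adj u v -> cod u v <= b.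
Hypothesis cls_adj : forall v w c c',
  cls v = Some c -> cls w = Some c' -> adj v w -> adj c c'.
Hypothesis low_deg : forall v, cls v = None -> 5 * deg v <= 13 * b.

Definition holes := \sum_v \sum_w miss v w.

Lemma adjR_pattern v w : ind v w <= pat v w - miss v w +
  ((cls v == None)%:R * ind v w + (cls w == None)%:R * ind v w).
Proof.
have -> : pat v w - miss v w = pat v w * ind v w by rewrite /missing; ring.
rewrite -!mulrDl /adjR; case: (boolP (adj v w)) => vw; last by rewrite !mulr0.
rewrite !mulr1 /pattern.
case cv: (cls v) => [c|]; case cw: (cls w) => [c'|]; last 3 first.
- by clear cv cw; rewrite /=; lra.
- by clear cv cw; rewrite /=; lra.
- by clear cv cw; rewrite /=; lra.
have -> : oadj (Some c) (Some c') = true by exact: cls_adj cv cw vw.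
by clear cv cw; rewrite /=; lra.
Qed.

(** The uncoloured vertices contribute at most their small degrees. *)
Lemma edge_count :
  \sum_v deg v <= \sum_v \sum_w pat v w - holes + 26 / 5 * b * csize None.
Proof.
have E : \sum_v \sum_w (cls v == None)%:R * ind v w <= 13 / 5 * b * csize None.
  rewrite class_size_sum mulr_sumr; apply: ler_sum => v _; rewrite -mulr_sumr.
  case: eqP => [/low_deg|_]; last by rewrite mul0r mulr0.
  by rewrite mul1r mulr1 -/(deg v); lra.
have E' : \sum_v \sum_w (cls w == None)%:R * ind v w <= 13 / 5 * b * csize None.
  rewrite exchange_big; apply: le_trans E; apply: ler_sum => v _.
  by apply: ler_sum => w _; rewrite adjRC.
apply: le_trans (_ : \sum_v \sum_w (pat v w - miss v w +
  ((cls v == None)%:R * ind v w + (cls w == None)%:R * ind v w)) <= _).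
  by apply: ler_sum => v _; apply: ler_sum => w _; apply: adjR_pattern.
have -> : \sum_v \sum_w (pat v w - miss v w +
  ((cls v == None)%:R * ind v w + (cls w == None)%:R * ind v w)) =
  \sum_v \sum_w pat v w - holes + (\sum_v \sum_w (cls v == None)%:R * ind v w
   + \sum_v \sum_w (cls w == None)%:R * ind v w).
  rewrite -sumrB -!big_split; apply: eq_bigr => v _ /=.
  by rewrite -sumrB -!big_split; apply: eq_bigr.
lra.
Qed.

Lemma sum_pattern3 : \sum_u \sum_v \sum_w pat u v * (pat u w * pat v w) =
  6 * (csize (Some (false, i0)) * csize (Some (false, i1)) * csize (Some (false, i2)) +
       csize (Some (true, i0)) * csize (Some (true, i1)) * csize (Some (true, i2))).
Proof.
pose f o1 o2 o3 : R := (oadj o1 o2)%:R * ((oadj o1 o3)%:R * (oadj o2 o3)%:R).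
transitivity (\sum_u (fun o1 => \sum_v (fun o2 => \sum_w f o1 o2 (cls w)) (cls v)) (cls u)) => //.
rewrite (sum_cls cls (fun o1 => \sum_v (fun o2 => \sum_w f o1 o2 (cls w)) (cls v))).
have sumv o1 : \sum_v (fun o2 => \sum_w f o1 o2 (cls w)) (cls v) = _ :=
  sum_cls cls (fun o2 => \sum_w f o1 o2 (cls w)).
have sumw o1 o2 : \sum_w f o1 o2 (cls w) = _ := sum_cls cls (f o1 o2).
have f1 o2 o3 : f None o2 o3 = 0 by rewrite /f /= mul0r.
have f2 o1 o3 : f o1 None o3 = 0 by rewrite /f (oadjC o1) mul0r.
have f3 o1 o2 : f o1 o2 None = 0.
  by rewrite /f (oadjC o1 None) mul0r mulr0.
have N1 : \sum_v (fun o2 => \sum_w f None o2 (cls w)) (cls v) = 0.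
  by apply: big1 => v _; apply: big1 => w _; apply: f1.
have N2 o1 : \sum_w f o1 None (cls w) = 0 by apply: big1 => w _; apply: f2.
rewrite N1 mulr0 add0r.
transitivity (\sum_c csize (Some c) * \sum_d csize (Some d) * \sum_e csize (Some e) * f (Some c) (Some d) (Some e)).
  apply: eq_bigr => c _; rewrite sumv N2 mulr0 add0r; congr (_ * _).
  by apply: eq_bigr => d _; rewrite sumw f3 mulr0 add0r.
rewrite !sum_prism /f /= /prism_adj /=; ring.
Qed.

Lemma pattern_cod_le U v w : (forall c, csize (Some c) <= U) -> pat v w = 1 ->
  \sum_s pat v s * pat w s <= U.
Proof.
move=> leU; rewrite /pattern.
case cv: (cls v) => [c|]; last by move/eqP; rewrite eq_sym oner_eq0.
case cw: (cls w) => [d|]; last by move/eqP; rewrite eq_sym oner_eq0.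
have U0 : 0 <= U by apply: le_trans (class_size_ge0 R cls (Some c)) (leU c).
rewrite (sum_cls cls (fun o => (oadj (Some c) o)%:R * (oadj (Some d) o)%:R)) /=.
rewrite mul0r mulr0 add0r sum_prism.
have := leU (false, i0); have := leU (false, i1); have := leU (false, i2).
have := leU (true, i0); have := leU (true, i1); have := leU (true, i2).
move: c d {cv cw}; apply: prism_case; apply: prism_case;
rewrite /= /prism_adj /= ?mul0r ?mulr0 ?mulr1 ?addr0 ?add0r => // ? ? ? ? ? ? /eqP;
by rewrite eq_sym oner_eq0.
Qed.

(** A missing pair destroys at most [U] triangles of the complete blow-up. *)
Lemma triangle_count U : (forall c, csize (Some c) <= U) ->
  6 * (csize (Some (false, i0)) * csize (Some (false, i1)) * csize (Some (false, i2)) +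
       csize (Some (true, i0)) * csize (Some (true, i1)) * csize (Some (true, i2)))
   - 3 * U * holes <= tau R G.
Proof.
move=> leU; rewrite -sum_pattern3.
have L1 : \sum_u \sum_v \sum_w miss u v * (pat u w * pat v w) <= U * holes.
  rewrite /holes mulr_sumr; apply: ler_sum => u _.
  rewrite mulr_sumr; apply: ler_sum => v _; rewrite -mulr_sumr.
  rewrite [U * _]mulrC; have := @missing_ge0 R G cls u v.
  rewrite le_eqVlt => /orP[/eqP<-|m0]; first by rewrite !mul0r.
  rewrite ler_pM2l //; apply: pattern_cod_le => //.
  move: m0; rewrite /missing /pattern; case: oadj => //.
  by rewrite mul0r ltxx.
have L2 : \sum_u \sum_v \sum_w miss u w * (pat u v * pat v w) <= U * holes.
  apply: le_trans L1; apply: ler_sum => u _; rewrite exchange_big.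
  by apply: ler_sum => v _; apply: ler_sum => w _; rewrite (patternC R cls w v).
have L3 : \sum_u \sum_v \sum_w miss v w * (pat u v * pat u w) <= U * holes.
  apply: le_trans L1; rewrite exchange_big; apply: ler_sum => u _.
  rewrite exchange_big; apply: ler_sum => v _; apply: ler_sum => w _.
  by rewrite (patternC R cls w u) (patternC R cls w v).
have : \sum_u \sum_v \sum_w pat u v * (pat u w * pat v w) <=
  tau R G + (\sum_u \sum_v \sum_w miss u v * (pat u w * pat v w) +
  (\sum_u \sum_v \sum_w miss u w * (pat u v * pat v w) +
   \sum_u \sum_v \sum_w miss v w * (pat u v * pat u w))).
  rewrite /tau /tri -!big_split; apply: ler_sum => u _ /=.
  rewrite -!big_split; apply: ler_sum => v _ /=.
  rewrite -!big_split; apply: ler_sum => w _ /=.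
  rewrite /missing /pattern /adjR; case: oadj => /=; last first.
    by rewrite !(mul0r, mulr0, add0r, mulr1); case: adj; case: adj; case: adj => /=; lra.
  case: oadj => /=; last first.
    by rewrite !(mul0r, mulr0, add0r, mulr1); case: adj; case: adj; case: adj => /=; lra.
  case: oadj => /=; last first.
    by rewrite !(mul0r, mulr0, add0r, mulr1); case: adj; case: adj; case: adj => /=; lra.
  by case: adj; case: adj; case: adj => /=; lra.
lra.
Qed.

Definition isc c v : R := (cls v == Some c)%:R.

Lemma isc_ge0 c v : 0 <= isc c v. Proof. exact: ler0n. Qed.

Definition holes_between c d := \sum_v \sum_w isc c v * isc d w * miss v w.

Lemma holes_betweenC c d : holes_between c d = holes_between d c.
Proof.
rewrite /holes_between exchange_big; apply: eq_bigr => v _; apply: eq_bigr => w _.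
by rewrite missingC [isc c w * _]mulrC.
Qed.

Lemma holes_three c d e : c != d -> c != e -> d != e ->
  2 * (holes_between d c + holes_between e c + holes_between d e) <= holes.
Proof.
move=> cd ce de; rewrite mulr2n mulrDl mul1r {2}(holes_betweenC d c).
rewrite {2}(holes_betweenC e c) {2}(holes_betweenC d e).
rewrite /holes_between -!big_split; apply: ler_sum => v _.
rewrite -!big_split; apply: ler_sum => w _ /=.
have := @missing_ge0 R G cls v w; move: (miss v w) => m m0; rewrite /isc.
case: (cls v) (cls w) => [f|] [g|] /=; rewrite ?mul0r ?mulr0 ?mul0r ?addr0 //.
rewrite !(inj_eq Some_inj).
have excl (h : prism) : [\/ [/\ (h == c) = false & (h == d) = false],
  [/\ (h == c) = false & (h == e) = false] | [/\ (h == d) = false & (h == e) = false]].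
  case: (eqVneq h c) => [->|_]; first by constructor 3; rewrite (negPf cd) (negPf ce).
  case: (eqVneq h d) => [->|_]; first by constructor 2; rewrite (negPf de).
  by constructor 1.
case: (excl f) => -[-> ->]; case: (excl g) => -[-> ->];
by case: (_ == _); case: (_ == _); rewrite /= ?mul0r ?mulr0 ?mul1r ?mul0r ?addr0 ?add0r.
Qed.

(** If the part [c] has more than [b] vertices, every edge between the other two parts
[d] and [e] of its triangle has at most [b] common neighbours in [c], which forces missing
pairs between the ends of the edge and [c]. *)
Lemma oversize U c d e : 0 <= b -> c != d -> c != e -> d != e ->
  adj d c -> adj e c -> adj d e ->
  (forall c, csize (Some c) <= U) -> b <= csize (Some c) ->
  2 * ((csize (Some c) - b) * csize (Some d) * csize (Some e)) <= U * holes.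
Proof.
move=> b0 cd ce de adc aec ade leU big; set r := csize (Some c) - b.
have r0 : 0 <= r by rewrite subr_ge0.
have U0 : 0 <= U by apply: le_trans (class_size_ge0 R cls (Some c)) (leU c).
have rU : r <= U by rewrite lerBlDr (le_trans (leU c)) // lerDl.
pose M v := \sum_s isc c s * miss v s.
have sz f : csize (Some f) = \sum_v isc f v by rewrite class_size_sum.
have M0 v : 0 <= M v by apply: sumr_ge0 => s _; rewrite mulr_ge0 ?isc_ge0 ?missing_ge0.
(* The common neighbours of an edge [vw] contain all of [c] up to missing pairs. *)
have point v w : isc d v * isc e w * r <= isc d v * isc e w * (M v + M w + r * miss v w).
  rewrite {1 3}/isc; case: eqP => [cv|_]; last by rewrite !mul0r.
  rewrite {1 2}/isc; case: eqP => [cw|_]; last by rewrite mulr0 !mul0r.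
  rewrite !mul1r; have [vw|vw] := boolP (adj v w); last first.
    have -> : miss v w = 1.
      rewrite /missing /adjR (negPf vw) /pattern cv cw.
      by have -> : oadj (Some d) (Some e) = true by []; rewrite subr0 mulr1.
    by rewrite mulr1 lerDr addr_ge0.
  apply: le_trans (_ : M v + M w <= _); last by rewrite lerDl mulr_ge0 ?missing_ge0.
  rewrite /r lerBlDr; apply: le_trans (_ : M v + M w + cod v w <= _); last first.
    by rewrite lerD2l cod_le.
  rewrite sz -!big_split; apply: ler_sum => s _ /=.
  rewrite /isc; case: eqP => [cs|_]; last by rewrite !mul0r !add0r mulr_ge0 ?adjR_ge0.
  rewrite /missing /pattern cv cw cs.
  have -> : oadj (Some d) (Some c) = true by [].
  have -> : oadj (Some e) (Some c) = true by [].
  rewrite /adjR; clear cv cw cs; by case: adj; case: adj; rewrite /=; lra.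
have : r * csize (Some d) * csize (Some e) <=
   csize (Some e) * holes_between d c + csize (Some d) * holes_between e c + r * holes_between d e.
  have -> : r * csize (Some d) * csize (Some e) = \sum_v \sum_w isc d v * isc e w * r.
    rewrite (sz d) [r * _]mulr_sumr mulr_suml; apply: eq_bigr => v _.
    by rewrite (sz e) mulr_sumr; apply: eq_bigr => w _; ring.
  apply: le_trans (_ : \sum_v \sum_w isc d v * isc e w * (M v + M w + r * miss v w) <= _).
    by apply: ler_sum => v _; apply: ler_sum => w _; apply: point.
  have -> : csize (Some e) * holes_between d c = \sum_v \sum_w isc d v * isc e w * M v.
    rewrite /holes_between sz mulr_sumr; apply: eq_bigr => v _.
    rewrite mulr_suml; apply: eq_bigr => w _; rewrite /M !mulr_sumr.
    by apply: eq_bigr => s _; ring.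
  have -> : csize (Some d) * holes_between e c = \sum_v \sum_w isc d v * isc e w * M w.
    rewrite /holes_between sz mulr_suml; apply: eq_bigr => v _.
    rewrite mulr_sumr; apply: eq_bigr => w _; rewrite /M !mulr_sumr.
    by apply: eq_bigr => s _; ring.
  have -> : r * holes_between d e = \sum_v \sum_w isc d v * isc e w * (r * miss v w).
    rewrite /holes_between mulr_sumr; apply: eq_bigr => v _.
    by rewrite mulr_sumr; apply: eq_bigr => w _; ring.
  rewrite -!big_split; apply: ler_sum => v _; rewrite -!big_split; apply: ler_sum => w _ /=.
  by rewrite !mulrDr lexx.
have hb0 f g : 0 <= holes_between f g.
  apply: sumr_ge0 => v _; apply: sumr_ge0 => w _.
  by apply: mulr_ge0; rewrite ?missing_ge0 // mulr_ge0 ?isc_ge0.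
have : csize (Some e) * holes_between d c <= U * holes_between d c by rewrite ler_wpM2r.
have : csize (Some d) * holes_between e c <= U * holes_between e c by rewrite ler_wpM2r.
have : r * holes_between d e <= U * holes_between d e by rewrite ler_wpM2r.
have : U * (2 * (holes_between d c + holes_between e c + holes_between d e)) <= U * holes.
  by rewrite ler_wpM2l // holes_three.
move: (holes_between d c) (holes_between e c) (holes_between d e) holes => x y z h.
lra.
Qed.

End CleanCount.

(** * The polynomial inequality *)

Section Algebra.
Variable R : realFieldType.
Implicit Types (a c b g w H T o rho k : R).

Definition cross (a0 a1 a2 c0 c1 c2 : R) :=
  a0 * c1 + a0 * c2 + a1 * c0 + a1 * c2 + a2 * c0 + a2 * c1.
Definition imbalance (a0 a1 a2 c0 c1 c2 : R) := (a0 + a1 + a2 - (c0 + c1 + c2)) ^+ 2.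
(** With parts of sizes [b - a_i] and [b - c_i], this form measures by how much the
numbers of edges and triangles together deviate from the extremal ones. *)
Definition excess_form (a0 a1 a2 c0 c1 c2 : R) :=
  imbalance a0 a1 a2 c0 c1 c2 + 4 * cross a0 a1 a2 c0 c1 c2.
Definition offsets (a0 a1 a2 c0 c1 c2 : R) :=
  (a0 - c0) ^+ 2 + (a1 - c1) ^+ 2 + (a2 - c2) ^+ 2.

(** The number of missing pairs is bounded by the edge count; inserting this bound in the
triangle count leaves the [excess_form], since the linear parts cancel. *)
Lemma excess_lower a0 a1 a2 c0 c1 c2 b g w H T o rho : 0 <= b ->
  a0 + a1 + a2 + (c0 + c1 + c2) = g + w ->
  2 * H <= imbalance a0 a1 a2 c0 c1 c2 - 2 * offsets a0 a1 a2 c0 c1 c2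
    - 3 / 2 * b * w + o ->
  6 * ((b - a0) * (b - a1) * (b - a2) + (b - c0) * (b - c1) * (b - c2))
    - 3 * (b + rho) * H <= T ->
  b * excess_form a0 a1 a2 c0 c1 c2 - 5 / 2 * b ^+ 2 * w - b * o
    - 4 * (a0 * a1 * a2 + c0 * c1 * c2) - 2 * rho * H <= 2 / 3 * (T - 6 * b ^+ 2 * (2 * b - g)).
Proof.
move=> b0 gE hE hT; have {gE}-> : g = a0 + a1 + a2 + (c0 + c1 + c2) - w by rewrite gE; ring.
have := ler_wpM2l b0 hE; rewrite /excess_form /imbalance /offsets /cross => {}hE.
lra.
Qed.

(** The squares of the differences between opposite parts sum to at least a third of the
imbalance, so nothing but an imbalance can pay for missing pairs and uncoloured
vertices. *)
Lemma imbalance_lower a0 a1 a2 c0 c1 c2 b w H o :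
  2 * H <= imbalance a0 a1 a2 c0 c1 c2 - 2 * offsets a0 a1 a2 c0 c1 c2
    - 3 / 2 * b * w + o ->
  6 * H + 9 / 2 * b * w - 3 * o <= imbalance a0 a1 a2 c0 c1 c2.
Proof.
have : imbalance a0 a1 a2 c0 c1 c2 <= 3 * offsets a0 a1 a2 c0 c1 c2.
  rewrite /imbalance /offsets.
  have := sqr_ge0 (a0 - c0 - (a1 - c1)); have := sqr_ge0 (a0 - c0 - (a2 - c2)).
  have := sqr_ge0 (a1 - c1 - (a2 - c2)); lra.
lra.
Qed.

Definition pair_sum (a0 a1 a2 : R) := a0 * a1 + a0 * a2 + a1 * a2.

(** The difference of the two sides is the sum of the squares of [a_i - c_i].  Through
this bound the form controls the cubic terms. *)
Lemma excess_form_pair_sum a0 a1 a2 c0 c1 c2 :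
  2 * pair_sum (a0 + c0) (a1 + c1) (a2 + c2) <= excess_form a0 a1 a2 c0 c1 c2.
Proof.
rewrite /pair_sum /excess_form /imbalance /cross.
have := sqr_ge0 (a0 - c0); have := sqr_ge0 (a1 - c1); have := sqr_ge0 (a2 - c2).
lra.
Qed.

Lemma prod3_le a0 a1 a2 K : 0 <= a0 <= K -> 0 <= a1 <= K -> 0 <= a2 <= K ->
  3 * (a0 * a1 * a2) <= K * pair_sum a0 a1 a2.
Proof.
move=> /andP[a00 a0K] /andP[a10 a1K] /andP[a20 a2K]; rewrite /pair_sum.
have : a0 * (a1 * a2) <= K * (a1 * a2) by rewrite ler_wpM2r ?mulr_ge0.
have : a1 * (a0 * a2) <= K * (a0 * a2) by rewrite ler_wpM2r ?mulr_ge0.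
have : a2 * (a0 * a1) <= K * (a0 * a1) by rewrite ler_wpM2r ?mulr_ge0.
lra.
Qed.

Lemma cross_ge0 a0 a1 a2 c0 c1 c2 : 0 <= a0 -> 0 <= a1 -> 0 <= a2 ->
  0 <= c0 -> 0 <= c1 -> 0 <= c2 -> 0 <= cross a0 a1 a2 c0 c1 c2.
Proof. by move=> *; rewrite /cross !addr_ge0 // mulr_ge0. Qed.

Lemma pair_sumD a0 a1 a2 c0 c1 c2 :
  pair_sum (a0 + c0) (a1 + c1) (a2 + c2) =
  pair_sum a0 a1 a2 + pair_sum c0 c1 c2 + cross a0 a1 a2 c0 c1 c2.
Proof. rewrite /pair_sum /cross; ring. Qed.

Lemma cubic_small a0 a1 a2 c0 c1 c2 K :
  0 <= a0 <= K -> 0 <= a1 <= K -> 0 <= a2 <= K ->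
  0 <= c0 <= K -> 0 <= c1 <= K -> 0 <= c2 <= K ->
  3 * (a0 * a1 * a2 + c0 * c1 * c2) <= K * pair_sum (a0 + c0) (a1 + c1) (a2 + c2).
Proof.
move=> ha0 ha1 ha2 hc0 hc1 hc2.
have pa := prod3_le ha0 ha1 ha2; have pc := prod3_le hc0 hc1 hc2.
move: ha0 ha1 ha2 hc0 hc1 hc2.
move=> /andP[a00 a0K] /andP[a10 _] /andP[a20 _] /andP[c00 _] /andP[c10 _] /andP[c20 _].
have K0 : 0 <= K by apply: le_trans a0K.
have cr := cross_ge0 a00 a10 a20 c00 c10 c20.
have := mulr_ge0 K0 cr; rewrite pair_sumD; move: pa pc.
move: (pair_sum a0 a1 a2) (pair_sum c0 c1 c2) (cross _ _ _ _ _ _) (a0 * a1 * a2) (c0 * c1 * c2).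
clear; move=> *; lra.
Qed.

Lemma cubic_small_form a0 a1 a2 c0 c1 c2 K :
  0 <= a0 <= K -> 0 <= a1 <= K -> 0 <= a2 <= K ->
  0 <= c0 <= K -> 0 <= c1 <= K -> 0 <= c2 <= K ->
  4 * (a0 * a1 * a2 + c0 * c1 * c2) <= K * excess_form a0 a1 a2 c0 c1 c2.
Proof.
move=> ha0 ha1 ha2 hc0 hc1 hc2.
have cs := cubic_small ha0 ha1 ha2 hc0 hc1 hc2.
have /andP[a00 a0K] := ha0; have K0 : 0 <= K by apply: le_trans a0K.
have := ler_wpM2l K0 (excess_form_pair_sum a0 a1 a2 c0 c1 c2).
have p0 : 0 <= a0 * a1 * a2 + c0 * c1 * c2.
  by case/andP: ha1; case/andP: ha2; case/andP: hc0; case/andP: hc1; case/andP: hc2 => *;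
     rewrite addr_ge0 ?mulr_ge0.
move: cs p0; clear; move: (a0 * a1 * a2 + _) (pair_sum _ _ _) (excess_form _ _ _ _ _ _) => *; lra.
Qed.

(** Shifting by [2 rho] makes a deviation nonnegative while bounding its absolute value,
which reduces the cubic terms to the case of nonnegative deviations. *)
Lemma norm_shift a rho K : - rho <= a <= K -> 0 <= rho <= K ->
  0 <= a + 2 * rho <= 3 * K /\ `|a| <= a + 2 * rho.
Proof.
move=> /andP[al aK] /andP[r0 rK]; split; first by apply/andP; split; lra.
by rewrite ler_norml; apply/andP; split; lra.
Qed.

Lemma prod3_norm a0 a1 a2 b0 b1 b2 : `|a0| <= b0 -> `|a1| <= b1 -> `|a2| <= b2 ->
  a0 * a1 * a2 <= b0 * b1 * b2.
Proof.
move=> h0 h1 h2; apply: le_trans (ler_norm _) _; rewrite !normrM.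
by rewrite !ler_pM ?mulr_ge0.
Qed.

(** When some part has [rho > 0] vertices more than [b], the missing pairs forced by it
outweigh everything that negative deviations can contribute. *)
Lemma excess_over a0 a1 a2 c0 c1 c2 b w H o rho k :
  0 < b -> 0 <= k -> 50 * k <= 1 -> 1 <= rho -> rho <= k * b -> 0 <= w -> o <= 1 ->
  - rho <= a0 <= k * b -> - rho <= a1 <= k * b -> - rho <= a2 <= k * b ->
  - rho <= c0 <= k * b -> - rho <= c1 <= k * b -> - rho <= c2 <= k * b ->
  3 / 2 * rho * b <= H ->
  6 * H + 9 / 2 * b * w - 3 * o <= imbalance a0 a1 a2 c0 c1 c2 ->
  0 < b * excess_form a0 a1 a2 c0 c1 c2 - 5 / 2 * b ^+ 2 * w - b * o
    - 4 * (a0 * a1 * a2 + c0 * c1 * c2) - 2 * rho * H.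
Proof.
move=> b0 k0 k50 r1 rk w0 o1 ha0 ha1 ha2 hc0 hc1 hc2 Hl Fl.
have hr : 0 <= rho <= k * b by apply/andP; split => //; lra.
have K0 : 0 <= k * b by case/andP: hr => /le_trans; apply.
have Kb : 50 * (k * b) <= b by have := ler_wpM2r (ltW b0) k50; lra.
have [ha0' na0] := norm_shift ha0 hr; have [ha1' na1] := norm_shift ha1 hr.
have [ha2' na2] := norm_shift ha2 hr; have [hc0' nc0] := norm_shift hc0 hr.
have [hc1' nc1] := norm_shift hc1 hr; have [hc2' nc2] := norm_shift hc2 hr.
have e3 : 4 * (a0 * a1 * a2 + c0 * c1 * c2) <=
   2 * (k * b) * excess_form a0 a1 a2 c0 c1 c2 + 384 * (k * b) * (k * b) * rho.
  have pa := prod3_norm na0 na1 na2; have pc := prod3_norm nc0 nc1 nc2.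
  have cs := cubic_small ha0' ha1' ha2' hc0' hc1' hc2'.
  have := ler_wpM2l K0 (excess_form_pair_sum a0 a1 a2 c0 c1 c2).
  have : (k * b) * pair_sum (a0 + 2 * rho + (c0 + 2 * rho)) (a1 + 2 * rho + (c1 + 2 * rho))
     (a2 + 2 * rho + (c2 + 2 * rho)) <=
   (k * b) * (pair_sum (a0 + c0) (a1 + c1) (a2 + c2) + 96 * rho * (k * b)).
    rewrite ler_wpM2l //.
    have -> : pair_sum (a0 + 2 * rho + (c0 + 2 * rho)) (a1 + 2 * rho + (c1 + 2 * rho))
     (a2 + 2 * rho + (c2 + 2 * rho)) = pair_sum (a0 + c0) (a1 + c1) (a2 + c2) +
       8 * (rho * (a0 + a1 + a2 + (c0 + c1 + c2))) + 48 * (rho * rho).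
      by rewrite /pair_sum; ring.
    have : rho * (a0 + a1 + a2 + (c0 + c1 + c2)) <= rho * (6 * (k * b)).
      case/andP: ha0; case/andP: ha1; case/andP: ha2.
      case/andP: hc0; case/andP: hc1; case/andP: hc2.
      clear -r1; move=> *; rewrite ler_wpM2l //; lra.
    have : rho * rho <= rho * (k * b) by rewrite ler_wpM2l //; clear -r1; lra.
    by clear; move: (pair_sum _ _ _) => *; lra.
  move: pa pc cs; clear.
  move: (pair_sum (a0 + c0) _ _) (pair_sum _ _ _) (excess_form _ _ _ _ _ _).
  move: (a0 * a1 * a2) (c0 * c1 * c2) ((_ + _) * _ * _) ((_ + _) * _ * _).
  by move=> *; lra.
have forml : imbalance a0 a1 a2 c0 c1 c2 - 72 * rho * (k * b) <= excess_form a0 a1 a2 c0 c1 c2.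
  have pr a c : - rho <= a <= k * b -> - rho <= c <= k * b -> - (3 * rho * (k * b)) <= a * c.
    move=> /andP[al au] /andP[cl cu].
    have : 0 <= (a + rho) * (c + rho) by rewrite mulr_ge0 // -lerBlDr sub0r.
    have : rho * (a + c + rho) <= rho * (3 * (k * b)).
      by rewrite ler_wpM2l //; clear -r1 au cu rk; lra.
    by clear; lra.
  rewrite /excess_form /cross.
  have := pr _ _ ha0 hc1; have := pr _ _ ha0 hc2; have := pr _ _ ha1 hc0.
  have := pr _ _ ha1 hc2; have := pr _ _ ha2 hc0; have := pr _ _ ha2 hc1.
  by clear; move: (imbalance _ _ _ _ _ _) => *; lra.
have H0 : 0 <= H by apply: le_trans Hl; rewrite !mulr_ge0 // ?ltW //; lra.
have rH : rho * H <= k * b * H by rewrite ler_wpM2r.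
move: e3 forml Fl; move: (imbalance _ _ _ _ _ _) (excess_form _ _ _ _ _ _) => F M.
move: (a0 * a1 * a2 + _) => E e3 forml Fl.
suff : 0 < b * ((1 - 2 * k) * M - 5 / 2 * b * w - o - 384 * k * (k * b) * rho - 2 * k * H).
  by move: e3 rH; clear; lra.
rewrite pmulr_rgt0 //.
have M1 : 24 / 25 * (6 * H + 9 / 2 * b * w - 3 - 72 * rho * (k * b)) <= (1 - 2 * k) * M.
  have k1 : 24 / 25 <= 1 - 2 * k by clear -k50; lra.
  have low : 6 * H + 9 / 2 * b * w - 3 - 72 * rho * (k * b) <= M by clear -forml Fl o1; lra.
  have rb : rho * (50 * (k * b)) <= rho * b by rewrite ler_wpM2l //; clear -r1; lra.
  have bw : 0 <= b * w by rewrite mulr_ge0 // ltW.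
  have rb1 : b <= rho * b by rewrite ler_peMl // ltW.
  have b50 : 50 <= b by clear -Kb r1 rk; lra.
  have low0 : 0 <= 6 * H + 9 / 2 * b * w - 3 - 72 * rho * (k * b).
    by clear -Hl rb bw rb1 b50; lra.
  apply: le_trans (_ : (1 - 2 * k) * (6 * H + 9 / 2 * b * w - 3 - 72 * rho * (k * b)) <= _).
    by rewrite ler_wpM2r.
  by rewrite ler_wpM2l //; clear -k1; lra.
have rb : rho * (50 * (k * b)) <= rho * b by rewrite ler_wpM2l //; clear -r1; lra.
have bw : 0 <= b * w by rewrite mulr_ge0 // ltW.
have rb1 : b <= rho * b by rewrite ler_peMl // ltW.
have b50 : 50 <= b by clear -Kb r1 rk; lra.
have kH : 50 * k * H <= 1 * H by rewrite ler_wpM2r.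
have kkb : 50 * k * (rho * (k * b)) <= 1 * (rho * (k * b)).
  by rewrite ler_wpM2r // mulr_ge0 //; clear -r1; lra.
by move: M1 rb bw rb1 b50 kH kkb Hl o1; clear; lra.
Qed.

Lemma excess_fit a0 a1 a2 c0 c1 c2 b w H o k :
  0 < b -> 0 <= k -> 50 * k <= 1 -> 0 <= H ->
  0 <= a0 <= k * b -> 0 <= a1 <= k * b -> 0 <= a2 <= k * b ->
  0 <= c0 <= k * b -> 0 <= c1 <= k * b -> 0 <= c2 <= k * b ->
  b * ((1 - k) * excess_form a0 a1 a2 c0 c1 c2 - 5 / 2 * b * w - o) <=
  b * excess_form a0 a1 a2 c0 c1 c2 - 5 / 2 * b ^+ 2 * w - b * o
    - 4 * (a0 * a1 * a2 + c0 * c1 * c2).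
Proof.
move=> b0 k0 k50 H0 ha0 ha1 ha2 hc0 hc1 hc2.
have := cubic_small_form ha0 ha1 ha2 hc0 hc1 hc2.
by clear; lra.
Qed.

End Algebra.

(** * Sizes of the parts in the extremal case *)

Lemma tau_card (R : realFieldType) (G : sgraph) : tau R G = 6 * #|triangles G|%:R.
Proof.
rewrite -[6]/(6%:R) -natrM -sum_adj_triangles !natr_sum /tau /tri.
apply: eq_bigr => x _; rewrite natr_sum; apply: eq_bigr => y _.
rewrite natr_sum; apply: eq_bigr => z _; rewrite /adjR.
by case: adj; case: adj; case: adj; rewrite /= ?mulr1 ?mulr0 ?mul0r.
Qed.

Lemma nat_sqr_dist (R : realFieldType) (p q : nat) :
  (p != q)%:R <= (p%:R - q%:R : R) ^+ 2.
Proof.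
wlog pq : p q / (p <= q)%N.
  move=> h; have [/h //|/ltnW/h] := leqP p q.
  by rewrite eq_sym -(sqrrN (_ - _)) opprB.
have [->|ne] := eqVneq p q; first by rewrite subrr expr0n.
have : (1 <= q - p)%N by rewrite subn_gt0 ltn_neqAle ne.
rewrite -(ler_nat R) natrB // => h /=.
have : 0 <= (q%:R - p%:R - 1 : R) * (q%:R - p%:R + 1) by rewrite mulr_ge0; lra.
lra.
Qed.

Definition flip_prism (f : bool) (i : 'I_3) (c : prism) : prism :=
  (c.1 (+) f, tperm i ord_max c.2).

(** The sizes are those of the extremal graph up to an automorphism of the prism. *)
Definition S_sizes (n b : nat) (sz : prism -> nat) : Prop :=
  exists f i, forall c, sz c = S_part_size b n (flip_prism f i c).

(** The vanishing products say that deviations sit at a single index, where the two parts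
differ by at most one. *)
Lemma S_sizes_of (n b x0 x1 x2 y0 y1 y2 : nat) (sz : prism -> nat) :
  (4 * b <= n)%N ->
  sz (false, i0) = (b - x0)%N -> sz (false, i1) = (b - x1)%N -> sz (false, i2) = (b - x2)%N ->
  sz (true, i0) = (b - y0)%N -> sz (true, i1) = (b - y1)%N -> sz (true, i2) = (b - y2)%N ->
  (x0 <= b)%N -> (x1 <= b)%N -> (x2 <= b)%N -> (y0 <= b)%N -> (y1 <= b)%N -> (y2 <= b)%N ->
  (x0 + x1 + x2 + (y0 + y1 + y2) + n = 6 * b)%N ->
  (x0 <= y0.+1)%N -> (x1 <= y1.+1)%N -> (x2 <= y2.+1)%N ->
  (y0 <= x0.+1)%N -> (y1 <= x1.+1)%N -> (y2 <= x2.+1)%N ->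
  ((x0 != y0) + (x1 != y1) + (x2 != y2) <= 1)%N ->
  (x0 * y1 = 0)%N -> (x0 * y2 = 0)%N -> (x1 * y0 = 0)%N ->
  (x1 * y2 = 0)%N -> (x2 * y0 = 0)%N -> (x2 * y1 = 0)%N ->
  S_sizes n b sz.
Proof.
move=> n4 s0 s1 s2 t0 t1 t2 x0b x1b x2b y0b y1b y2b sum d0 d1 d2 e0 e1 e2 one.
have z m k : (m * k = 0)%N -> (m == 0)%N || (k == 0)%N by move/eqP; rewrite muln_eq0.
move=> /z z01 /z z02 /z z10 /z z12 /z z20 /z z21.
have [i [u [v [iE uv [su tv others]]]]] : exists i u v,
  [/\ (u + v = n - 4 * b)%N, (u <= v.+1)%N /\ (v <= u.+1)%N &
      [/\ sz (false, i) = u, sz (true, i) = v & forall c, c.2 != i -> sz c = b]].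
  have [h|[h|h]] : (x1 + y1 + x2 + y2 = 0 \/ x0 + y0 + x2 + y2 = 0 \/
      x0 + y0 + x1 + y1 = 0)%N.
    have two x y x' y' : (x == 0)%N || (y' == 0)%N -> (x' == 0)%N || (y == 0)%N ->
        (0 < x + y)%N -> (0 < x' + y')%N -> (x != y) /\ (x' != y').
      by clear => /orP[]/eqP -> /orP[]/eqP -> p p'; split; apply/eqP; lia.
    case: (posnP (x0 + y0)) => p0; case: (posnP (x1 + y1)) => p1;
    case: (posnP (x2 + y2)) => p2; try (clear -p0 p1 p2; lia).
    - by have [e e'] := two _ _ _ _ z12 z21 p1 p2; move: one; rewrite e e'; case: (_ != _).
    - by have [e e'] := two _ _ _ _ z02 z20 p0 p2; move: one; rewrite e e'; case: (_ != _).
    - by have [e e'] := two _ _ _ _ z01 z10 p0 p1; move: one; rewrite e e'; case: (_ != _).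
    - by have [e e'] := two _ _ _ _ z01 z10 p0 p1; move: one; rewrite e e'; case: (_ != _).
  - exists i0, (b - x0)%N, (b - y0)%N; clear z z01 z02 z10 z12 z20 z21 one.
    split; [clear -h sum x0b y0b n4; lia|clear -x0b y0b d0 e0; lia|split=> //].
    by apply: prism_case => //= _; rewrite ?s1 ?s2 ?t1 ?t2; clear -h; lia.
  - exists i1, (b - x1)%N, (b - y1)%N; clear z z01 z02 z10 z12 z20 z21 one.
    split; [clear -h sum x1b y1b n4; lia|clear -x1b y1b d1 e1; lia|split=> //].
    by apply: prism_case => //= _; rewrite ?s0 ?s2 ?t0 ?t2; clear -h; lia.
  - exists i2, (b - x2)%N, (b - y2)%N; clear z z01 z02 z10 z12 z20 z21 one.
    split; [clear -h sum x2b y2b n4; lia|clear -x2b y2b d2 e2; lia|split=> //].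
    by apply: prism_case => //= _; rewrite ?s1 ?s0 ?t1 ?t0; clear -h; lia.
have ui : (u = (n - 4 * b)./2 /\ v = uphalf (n - 4 * b)) \/
  (v = (n - 4 * b)./2 /\ u = uphalf (n - 4 * b)).
  rewrite -iE; clear -uv; have := odd_double_half (u + v); rewrite uphalf_half.
  case: uv => ? ?; case: (odd _) (u + v)./2 => h /=; rewrite -addnn => ?.
    by have [?|?] := leqP u v; [left|right]; lia.
  by left; lia.
have tp (j : 'I_3) : (tperm i ord_max j == ord_max) = (j == i).
  have -> : (j == i) = (tperm i ord_max j == tperm i ord_max i).
    by rewrite (inj_eq perm_inj).
  by rewrite tpermL.
case: ui => [[uE vE]|[vE uE]]; [exists false|exists true]; exists i => -[s j];
rewrite /S_part_size /flip_prism /= tp /=; case: eqP => [->|/eqP ji];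
try exact: others; by case: s; rewrite /= ?su ?tv ?uE ?vE.
Qed.

(** * The lower bound for the number of triangles *)

Lemma holes_le (R : realFieldType) (b n w p0 p1 p2 q0 q1 q2 P2 D H o : R) :
  0 <= b -> 0 <= w -> 119 / 10 * b <= 2 * n - w ->
  n = w + (p0 + p1 + p2) + (q0 + q1 + q2) ->
  2 * P2 = (p0 + p1 + p2 + (q0 + q1 + q2)) ^+ 2 + (p0 + p1 + p2 - (q0 + q1 + q2)) ^+ 2
    - 2 * ((p0 - q0) ^+ 2 + (p1 - q1) ^+ 2 + (p2 - q2) ^+ 2) ->
  - o <= 2 * D - n * n ->
  D <= P2 - H + 26 / 5 * b * w ->
  2 * H <= imbalance (b - p0) (b - p1) (b - p2) (b - q0) (b - q1) (b - q2)
     - 2 * offsets (b - p0) (b - p1) (b - p2) (b - q0) (b - q1) (b - q2)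
    - 3 / 2 * b * w + o.
Proof.
move=> b0 w0 nw nE quad edge total.
have -> : imbalance (b - p0) (b - p1) (b - p2) (b - q0) (b - q1) (b - q2) =
  (p0 + p1 + p2 - (q0 + q1 + q2)) ^+ 2 by rewrite /imbalance; ring.
have -> : offsets (b - p0) (b - p1) (b - p2) (b - q0) (b - q1) (b - q2) =
  (p0 - q0) ^+ 2 + (p1 - q1) ^+ 2 + (p2 - q2) ^+ 2 by rewrite /offsets; ring.
have pqE : p0 + p1 + p2 + (q0 + q1 + q2) = n - w by rewrite nE; ring.
rewrite pqE in quad.
(* As [n] is nearly [6 b], leaving out [w] vertices takes almost [12 b w] from [n^2]. *)
have := mulr_ge0 w0 (_ : 0 <= 2 * n - w - 119 / 10 * b).
rewrite subr_ge0 => /(_ nw).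
move: quad edge total; clear.
move: ((p0 + p1 + p2 - _) ^+ 2) ((p0 - q0) ^+ 2 + _ + _) => F S *; lra.
Qed.

Lemma nat_sqr_le1 (R : realFieldType) (x y : nat) :
  (x%:R - y%:R : R) ^+ 2 <= 1 -> (x <= y.+1)%N.
Proof.
move=> h; rewrite leqNgt; apply/negP => lt.
have : (y.+2)%:R <= x%:R :> R by rewrite ler_nat.
rewrite -addn2 natrD => {}lt.
have : 0 <= (x%:R - y%:R - 2) * (x%:R - y%:R + 2 : R).
  by have := ler0n R y; rewrite mulr_ge0 //; lra.
lra.
Qed.

Section Conclusion.
Variables (R : realFieldType) (G : sgraph) (b : nat) (e : R) (cls : G -> option prism).
Local Notation n := (#|G|).
Local Notation bR := (b%:R : R).
Local Notation csize := (@class_size R G cls).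
Local Notation p i := (csize (Some (false, i))).
Local Notation q i := (csize (Some (true, i))).
Local Notation H := (@holes R G cls).
Local Notation w := (csize None).
Local Notation o := ((odd n)%:R : R).

Hypothesis dense : (#|G| ^ 2 %/ 4 <= #|edges G|)%N.
Hypothesis cod_le : forall u v : G, adj u v -> cod R u v <= bR.
Hypothesis b_gt0 : (0 < b)%N.
Hypothesis n_le : (n <= 6 * b)%N.
Hypothesis n_ge : (4 * b <= n)%N.
Hypothesis e_ge0 : 0 <= e.
Hypothesis e_le : 1000 * e <= 1.
Hypothesis defect_le : 6 * bR - n%:R <= e * bR.
Hypothesis cls_adj : forall v w c c',
  cls v = Some c -> cls w = Some c' -> adj v w -> adj c c'.
Hypothesis low_deg : forall v, cls v = None -> 5 * deg R v <= 13 * bR.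
Hypothesis size_ge : forall c, (1 - e) * bR <= csize (Some c).

Let bR0 : 0 < bR. Proof. by rewrite ltr0n. Qed.
Let nR : n%:R <= 6 * bR. Proof. by rewrite -[6]/(6%:R) -natrM ler_nat. Qed.
Let eb0 : 0 <= e * bR. Proof. by rewrite mulr_ge0. Qed.
Let eb : 1000 * (e * bR) <= bR.
Proof. by have := ler_wpM2r (ltW bR0) e_le; rewrite mul1r mulrA. Qed.
Let sizes : n%:R = w + (p i0 + p i1 + p i2) + (q i0 + q i1 + q i2).
Proof. exact: sum_class_size. Qed.
Let w0 : 0 <= w. Proof. exact: class_size_ge0. Qed.
Let o1 : o <= 1. Proof. by rewrite lern1 leq_b1. Qed.
Let H0 : 0 <= H.
Proof. by apply: sumr_ge0 => v _; apply: sumr_ge0 => u _; apply: missing_ge0. Qed.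

Lemma w_le : w <= 6 * (e * bR).
Proof.
move: sizes nR (size_ge (false, i0)) (size_ge (false, i1)) (size_ge (false, i2)).
by move: (size_ge (true, i0)) (size_ge (true, i1)) (size_ge (true, i2)); lra.
Qed.

Lemma size_le c : csize (Some c) <= bR + 5 * (e * bR).
Proof.
move: sizes nR w0 (size_ge (false, i0)) (size_ge (false, i1)) (size_ge (false, i2)).
move: (size_ge (true, i0)) (size_ge (true, i1)) (size_ge (true, i2)).
by move: c; apply: prism_case; lra.
Qed.

Lemma size_dev c : bR - csize (Some c) <= 5 * e * bR.
Proof. by move: (size_ge c) eb0; lra. Qed.

Local Notation Fimb := (imbalance (bR - p i0) (bR - p i1) (bR - p i2) (bR - q i0) (bR - q i1) (bR - q i2)).
Local Notation Foff := (offsets (bR - p i0) (bR - p i1) (bR - p i2) (bR - q i0) (bR - q i1) (bR - q i2)).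
Local Notation Fform := (excess_form (bR - p i0) (bR - p i1) (bR - p i2) (bR - q i0) (bR - q i1) (bR - q i2)).

Lemma holes_bound : 2 * H <= Fimb - 2 * Foff - 3 / 2 * bR * w + o.
Proof.
have edge := sum_dev R dense.
rewrite /dev sumrB -mulr_sumr sum_cst in edge.
apply: (holes_le (ltW bR0) w0 _ sizes (sum_pattern_quad R cls) edge).
- by move: w_le eb eb0 defect_le w0; lra.
- exact: edge_count.
Qed.

Lemma triangle_lower rho : (forall c, csize (Some c) <= bR + rho) ->
  bR * Fform - 5 / 2 * bR ^+ 2 * w - bR * o
    - 4 * ((bR - p i0) * (bR - p i1) * (bR - p i2) + (bR - q i0) * (bR - q i1) * (bR - q i2))
    - 2 * rho * H
  <= 4 * (#|triangles G|%:R - (b ^ 2 * (n - 4 * b))%:R).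
Proof.
move=> leU; have := triangle_count leU.
have -> : p i0 * p i1 * p i2 + q i0 * q i1 * q i2 =
  (bR - (bR - p i0)) * (bR - (bR - p i1)) * (bR - (bR - p i2)) +
  (bR - (bR - q i0)) * (bR - (bR - q i1)) * (bR - (bR - q i2)) by ring.
move=> T; apply: le_trans (excess_lower (g := 6 * bR - n%:R) (ltW bR0) _ holes_bound T) _.
  by rewrite sizes; ring.
rewrite tau_card natrM natrB // natrX natrM; lra.
Qed.

Lemma oversize_holes c rho : (forall d, csize (Some d) <= bR + rho) ->
  csize (Some c) = bR + rho -> 0 <= rho -> 3 / 2 * rho * bR <= H.
Proof.
move=> leU cE r0.
have rho_le : rho <= 5 * (e * bR) by have := size_le c; rewrite cE; lra.
have [d [f [[cd cf df] [adc afc adf]]]] : exists d f : prism,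
  [/\ c != d, c != f & d != f] /\ [/\ adj d c, adj f c & adj d f].
  move: c {cE}; apply: prism_case;
  [exists (false, i1), (false, i2)|exists (false, i0), (false, i2)
  |exists (false, i0), (false, i1)|exists (true, i1), (true, i2)
  |exists (true, i0), (true, i2)|exists (true, i0), (true, i1)]; by [].
have := oversize cod_le (ltW bR0) cd cf df adc afc adf leU.
rewrite cE => /(_ _); rewrite lerDl => /(_ r0).
rewrite (addrC bR) addrK => over.
have pp : (9 / 10 * bR) * (9 / 10 * bR) <= csize (Some d) * csize (Some f).
  have nine f' : 9 / 10 * bR <= csize (Some f') by move: (size_ge f') eb eb0; lra.
  have nine0 : 0 <= 9 / 10 * bR by move: bR0; lra.
  exact: ler_pM.
have : rho * ((9 / 10 * bR) * (9 / 10 * bR)) <= rho * (csize (Some d) * csize (Some f)).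
  by rewrite ler_wpM2l.
have : (bR + rho) * H <= (101 / 100 * bR) * H.
  by rewrite ler_wpM2r //; move: rho_le eb; lra.
move=> h1 h2; rewrite -(ler_pM2l bR0); move: h1 h2 over.
have : 0 <= rho * bR * bR by rewrite !mulr_ge0 // ltW.
lra.
Qed.

(** Take the largest part: its excess [rho] forces at least [3/2 rho b] missing pairs. *)
Lemma strict_over c : bR < csize (Some c) -> (b ^ 2 * (n - 4 * b) < #|triangles G|)%N.
Proof.
move=> bc.
pose sz (c : prism) := #|[set v | cls v == Some c]|.
have [d _ dmax] := arg_maxnP sz (isT : xpredT c).
pose rho := csize (Some d) - bR.
have leU f : csize (Some f) <= bR + rho.
  by rewrite /rho addrC subrK ler_nat; apply: dmax.
have dE : csize (Some d) = bR + rho by rewrite /rho addrC subrK.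
have r1 : 1 <= rho.
  have : bR < csize (Some d) by apply: lt_le_trans bc _; rewrite ler_nat; apply: dmax.
  rewrite /rho /class_size ltr_nat -(ler_nat R) -natr1; lra.
have r0 : 0 <= rho by lra.
have rk : rho <= 5 * e * bR by have := size_le d; rewrite /rho; lra.
have Hl := oversize_holes leU dE r0.
have bnd f : - rho <= bR - csize (Some f) <= 5 * e * bR.
  by apply/andP; split; [have := leU f; lra|exact: size_dev].
have k0 : 0 <= 5 * e by rewrite mulr_ge0.
have k50 : 50 * (5 * e) <= 1 by move: e_le e_ge0; lra.
have := excess_over bR0 k0 k50 r1 rk w0 o1 (bnd _) (bnd _) (bnd _) (bnd _) (bnd _) (bnd _)
  Hl (imbalance_lower holes_bound).
move=> /lt_le_trans /(_ (triangle_lower leU)).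
by rewrite pmulr_rgt0 // subr_gt0 ltr_nat.
Qed.

Local Notation sz := (fun c : prism => #|[set v | cls v == Some c]|).
Hypothesis size_fit : forall c, csize (Some c) <= bR.

Let fitU c : csize (Some c) <= bR + 0. Proof. by rewrite addr0. Qed.

Let k0 : 0 <= 5 * e. Proof. by rewrite mulr_ge0. Qed.

Let rng c : 0 <= bR - csize (Some c) <= 5 * e * bR.
Proof. by rewrite subr_ge0 size_fit size_dev. Qed.

Let gap0 c : 0 <= bR - csize (Some c). Proof. by rewrite subr_ge0 size_fit. Qed.

Let cross0 : 0 <= cross (bR - p i0) (bR - p i1) (bR - p i2) (bR - q i0) (bR - q i1) (bR - q i2).
Proof. exact: cross_ge0. Qed.

Let form_imbalance : Fimb <= Fform.
Proof. by rewrite /excess_form lerDl mulr_ge0. Qed.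

Let fit_lower : bR * ((1 - 5 * e) * Fform - 5 / 2 * bR * w - o) <=
  4 * (#|triangles G|%:R - (b ^ 2 * (n - 4 * b))%:R).
Proof.
have k50 : 50 * (5 * e) <= 1 by move: e_le e_ge0; lra.
apply: le_trans (excess_fit w o bR0 k0 k50 H0 (rng _) (rng _) (rng _) (rng _) (rng _) (rng _)) _.
by have := triangle_lower fitU; rewrite mulr0 mul0r subr0.
Qed.

(** Uncoloured vertices lose edges, which only an imbalance can replace, and the imbalance
brings more triangles than the uncoloured vertices lose. *)
Lemma strict_low : w != 0 -> (b ^ 2 * (n - 4 * b) < #|triangles G|)%N.
Proof.
move=> wn0; have w1 : 1 <= w.
  by move: wn0; rewrite /class_size pnatr_eq0 -lt0n ler1n.
have wl := w_le; have b100 : 100 <= bR by move: eb wl w1; lra.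
have bw : bR <= bR * w by rewrite ler_peMr // ltW.
have F := imbalance_lower holes_bound.
have low : 0 <= 9 / 2 * bR * w - 3 by move: bw b100; lra.
have forml : 9 / 2 * bR * w - 3 <= Fform.
  by apply: le_trans form_imbalance; move: F H0 o1; move: Fimb => f; lra.
have M1 : 9 / 10 * (9 / 2 * bR * w - 3) <= (1 - 5 * e) * Fform.
  apply: le_trans (_ : (1 - 5 * e) * (9 / 2 * bR * w - 3) <= _).
    by rewrite ler_wpM2r //; move: e_le e_ge0; lra.
  by rewrite ler_wpM2l //; move: e_le e_ge0; lra.
have pos : 0 < (1 - 5 * e) * Fform - 5 / 2 * bR * w - o.
  by move: M1 o1 bw b100; move: Fform => f; lra.
move: (lt_le_trans (mulr_gt0 bR0 pos) fit_lower).
by rewrite pmulr_rgt0 // subr_gt0 ltr_nat.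
Qed.

Hypothesis no_low : w = 0.

Let x c : nat := (b - sz c)%N.
Let szb c : (sz c <= b)%N. Proof. by have := size_fit c; rewrite ler_nat. Qed.
Let xE c : bR - csize (Some c) = (x c)%:R. Proof. by rewrite natrB. Qed.

Let sizes_nat : n = (sz (false, i0) + sz (false, i1) + sz (false, i2)
   + (sz (true, i0) + sz (true, i1) + sz (true, i2)))%N.
Proof.
have := sizes; rewrite no_low add0r /class_size -!natrD => /eqP.
by rewrite eqr_nat => /eqP.
Qed.

Let odd_imb : o <= Fimb.
Proof.
have -> : Fimb = ((sz (true, i0) + sz (true, i1) + sz (true, i2))%:R -
  (sz (false, i0) + sz (false, i1) + sz (false, i2))%:R) ^+ 2.
  by rewrite /imbalance !natrD /class_size; ring.
apply: le_trans (nat_sqr_dist R _ _); rewrite ler_nat sizes_nat.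
by case: eqVneq => [->|_]; rewrite ?addnn ?odd_double // leq_b1.
Qed.

Let E3 : R := (bR - p i0) * (bR - p i1) * (bR - p i2) + (bR - q i0) * (bR - q i1) * (bR - q i2).

(** The form is at least 6 if three deviations at the same triangle are positive, so it
exceeds the parity term even after paying for the cubic terms. *)
Lemma strict_cubic : E3 != 0 -> (b ^ 2 * (n - 4 * b) < #|triangles G|)%N.
Proof.
move=> En0.
have ge1 c : bR - csize (Some c) != 0 -> 1 <= bR - csize (Some c).
  by rewrite xE pnatr_eq0 -lt0n ler1n.
have three (f : 'I_3 -> R) : (forall i, 0 <= f i) -> (forall i, f i != 0 -> 1 <= f i) ->
    f i0 * f i1 * f i2 != 0 -> 3 <= pair_sum (f i0) (f i1) (f i2).
  move=> f0 f1; rewrite !mulf_eq0 !negb_or => /andP[/andP[h0 h1] h2].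
  have m i j : f i != 0 -> f j != 0 -> 1 <= f i * f j.
    by move=> hi hj; rewrite -[1]mulr1 ler_pM ?f1.
  by rewrite /pair_sum; have := m _ _ h0 h1; have := m _ _ h0 h2; have := m _ _ h1 h2; lra.
have pg a0 a1 a2 : 0 <= a0 -> 0 <= a1 -> 0 <= a2 -> 0 <= pair_sum a0 a1 a2 :> R.
  by move=> *; rewrite /pair_sum !addr_ge0 ?mulr_ge0.
have form6 : 6 <= Fform.
  apply: le_trans (excess_form_pair_sum _ _ _ _ _ _); rewrite pair_sumD.
  have pU := pg _ _ _ (gap0 (false, i0)) (gap0 (false, i1)) (gap0 (false, i2)).
  have pV := pg _ _ _ (gap0 (true, i0)) (gap0 (true, i1)) (gap0 (true, i2)).
  have [U0|Un0] := eqVneq ((bR - p i0) * (bR - p i1) * (bR - p i2)) 0.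
    have := three (fun i => bR - q i) (fun i => gap0 _) (fun i => @ge1 _).
    move: En0; rewrite /E3 U0 add0r => Vn0 /(_ Vn0).
    by move: pU cross0; lra.
  have := three (fun i => bR - p i) (fun i => gap0 _) (fun i => @ge1 _) Un0.
  by move: pV cross0; lra.
have M1 : 9 / 10 * 6 <= (1 - 5 * e) * Fform.
  by apply: ler_pM => //; move: e_le e_ge0; lra.
have pos : 0 < (1 - 5 * e) * Fform - 5 / 2 * bR * w - o.
  by rewrite no_low mulr0 subr0; move: M1 o1; lra.
move: (lt_le_trans (mulr_gt0 bR0 pos) fit_lower).
by rewrite pmulr_rgt0 // subr_gt0 ltr_nat.
Qed.

Hypothesis no_cubic : E3 = 0.

Let flat_lower : bR * (Fform - o) <= 4 * (#|triangles G|%:R - (b ^ 2 * (n - 4 * b))%:R).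
Proof.
have := triangle_lower fitU; rewrite -/E3 no_cubic no_low !mulr0 mul0r !subr0.
by rewrite [bR * (_ - _)]mulrBr.
Qed.

Lemma flat_le : (b ^ 2 * (n - 4 * b) <= #|triangles G|)%N.
Proof.
have : 0 <= bR * (Fform - o).
  by rewrite mulr_ge0 ?(ltW bR0) // subr_ge0 (le_trans odd_imb).
by move/le_trans => /(_ _ flat_lower); rewrite pmulr_rge0 // subr_ge0 ler_nat.
Qed.

(** Equality forces the form to equal the parity term; then the edge count leaves no
room for missing pairs nor for differences between opposite parts beyond parity. *)
Lemma flat_eq : #|triangles G| = (b ^ 2 * (n - 4 * b))%N -> H = 0 /\ S_sizes n b sz.
Proof.
move=> tE; have := flat_lower; rewrite tE subrr mulr0 pmulr_rle0 // => mo.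
have cr0 : cross (bR - p i0) (bR - p i1) (bR - p i2) (bR - q i0) (bR - q i1) (bR - q i2) <= 0.
  by move: mo odd_imb; rewrite /excess_form; move: Fimb => f; lra.
have Fo : Fimb <= o by move: mo cross0; rewrite /excess_form; move: Fimb => f; lra.
have hb := holes_bound; rewrite no_low mulr0 subr0 in hb.
pose U i := x (false, i); pose V i := x (true, i).
pose ne := ((U i0 != V i0) + (U i1 != V i1) + (U i2 != V i2))%N.
have offE : Foff = ((U i0)%:R - (V i0)%:R) ^+ 2 + ((U i1)%:R - (V i1)%:R) ^+ 2 +
   ((U i2)%:R - (V i2)%:R) ^+ 2 by rewrite /offsets !xE.
have neoff : ne%:R <= Foff.
  by rewrite offE !natrD !lerD ?nat_sqr_dist.
have one : o <= ne%:R.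
  rewrite ler_nat; case: (posnP ne) => [/eqP|]; last by apply: leq_trans; rewrite leq_b1.
  rewrite /ne !addn_eq0 !eqb0 !negbK => /andP[/andP[/eqP e0 /eqP e1] /eqP e2].
  have : Fimb = 0 by rewrite /imbalance !xE -/(U _) -/(V _) -/(U _) -/(U _) -/(V _) -/(V _) e0 e1 e2; ring.
  by move: odd_imb => /[swap] ->; rewrite lern0; case: odd.
have Hle : H <= 0 by move: hb Fo one neoff; move: Fimb Foff => f s; lra.
have off1 : Foff <= 1 by move: hb Fo H0 o1; move: Fimb Foff => f s; lra.
split; first by apply/eqP; rewrite eq_le Hle H0.
have ne1 : (ne <= 1)%N by rewrite -(ler_nat R) (le_trans neoff).
have dist i : (U i <= (V i).+1)%N /\ (V i <= (U i).+1)%N.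
  have : ((U i)%:R - (V i)%:R : R) ^+ 2 <= 1.
    apply: le_trans off1; rewrite offE.
    have s0 := sqr_ge0 ((U i0)%:R - (V i0)%:R : R).
    have s1 := sqr_ge0 ((U i1)%:R - (V i1)%:R : R).
    have s2 := sqr_ge0 ((U i2)%:R - (V i2)%:R : R).
    by case: (ord3P i) => ->; lra.
  move=> h; split; first exact: nat_sqr_le1 h.
  by apply: (nat_sqr_le1 (R := R)); rewrite -(sqrrN (_ - _)) opprB.
move: cr0; rewrite /cross !xE -!natrM -!natrD lern0 -/(U _) !addn_eq0.
move=> /andP[/andP[/andP[/andP[/andP[/eqP z1 /eqP z2] /eqP z3] /eqP z4] /eqP z5] /eqP z6].
have [d0 f0] := dist i0; have [d1 f1] := dist i1; have [d2 f2] := dist i2.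
have szx c : sz c = (b - x c)%N by rewrite /x subKn.
have xb c : (x c <= b)%N := leq_subr _ _.
apply: (S_sizes_of n_ge (szx (false, i0)) (szx (false, i1)) (szx (false, i2))
  (szx (true, i0)) (szx (true, i1)) (szx (true, i2)) (xb _) (xb _) (xb _) (xb _) (xb _) (xb _)
  _ d0 d1 d2 f0 f1 f2 ne1 z1 z2 z3 z4 z5 z6).
have := sizes_nat; rewrite !szx.
have := xb (false, i0); have := xb (false, i1); have := xb (false, i2).
have := xb (true, i0); have := xb (true, i1); have := xb (true, i2).
move: (x (false, i0)) (x (false, i1)) (x (false, i2)) => a0 a1 a2.
move: (x (true, i0)) (x (true, i1)) (x (true, i2)) => a3 a4 a5.
move: #|G| => N; clear; lia.
Qed.

End Conclusion.

(** * Isomorphisms and the theorem *)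

Lemma rank_in_fiber (T : finType) (S : eqType) (ty : T -> S) (m : S -> nat) :
  (forall s, #|[set w | ty w == s]| = m s) ->
  forall v, (index v (enum [set w | ty w == ty v]) < m (ty v))%N.
Proof. by move=> card v; rewrite -card cardE index_mem mem_enum inE. Qed.

Lemma rank_inj (T : finType) (S : eqType) (ty : T -> S) v w : ty v = ty w ->
  index v (enum [set u | ty u == ty v]) = index w (enum [set u | ty u == ty w]) -> v = w.
Proof.
by move=> E; rewrite E; apply: (index_inj v); rewrite mem_enum inE ?E.
Qed.

(** Vertices are numbered inside their classes. *)
Lemma blowup_isomorphic (G H : sgraph) (m : H -> nat) (ty : G -> H) :
  (forall v w, adj v w = adj (ty v) (ty w)) ->
  (forall c, #|[set v | ty v == c]| = m c) -> isomorphic G (blowup m).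
Proof.
move=> adjE card.
pose f v : blowup m := Tagged (fun c => 'I_(m c)) (Ordinal (rank_in_fiber card v)).
exists f; split; last by move=> x y; rewrite adjE.
have f_inj : injective f.
  move=> v w E; have tE : ty v = ty w := congr1 tag E.
  have := congr1 (fun y : blowup m => nat_of_ord (tagged y)) E; exact: rank_inj.
apply: inj_card_bij => //; rewrite card_tagged.
rewrite sumnE big_map big_enum /=.
under eq_bigr => c _ do rewrite card_ord -card.
by rewrite -sum1_card (partition_big ty xpredT) //= leq_sum // => c _; rewrite sum1dep_card.
Qed.

Lemma fiber_card_blowup (G H : sgraph) (m : H -> nat) (f : G -> blowup m) c :
  bijective f -> #|[set v | tag (f v) == c]| = m c.
Proof.
move=> bf; have -> : [set v | tag (f v) == c] = f @^-1: [set y | tag y == c].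
  by apply/setP => v; rewrite !inE.
rewrite on_card_preimset; last exact: onW_bij.
rewrite -[RHS]card_ord -cardsT.
have inj : injective (@Tagged H c (fun c => 'I_(m c))).
  by move=> i j /eqP; rewrite eq_Tagged => /eqP.
rewrite -(card_imset _ inj); apply: eq_card => y; rewrite inE.
apply/eqP/imsetP => [|[i _ ->] //].
by case: y => d i /= dc; subst d; exists i.
Qed.

Section TriangleFree.
Variables (G : sgraph) (col : G -> bool).
Hypothesis col_adj : forall v w, adj v w = (col v != col w).
Local Open Scope nat_scope.

Let side (s : bool) := #|[set v | col v == s]|.

Lemma edges_sides : #|edges G| = side true * side false.
Proof.
have := sum_adj_edges G.
have -> : \sum_(x : G) \sum_(y : G) adj x y = \sum_(x : G) side (~~ col x).
  apply: eq_bigr => x _; rewrite /side -sum1dep_card [RHS]big_mkcond /=.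
  by apply: eq_bigr => y _; rewrite col_adj; case: (col x) (col y) => [] [].
rewrite (bigID col) /=.
have -> : \sum_(x | col x) side (~~ col x) = side true * side false.
  rewrite (eq_bigr (fun=> side false)) => [|x -> //].
  rewrite sum_nat_const; congr (_ * _).
  by apply: eq_card => v; rewrite !inE eqb_id.
have -> : \sum_(x | ~~ col x) side (~~ col x) = side true * side false.
  rewrite (eq_bigr (fun=> side true)) => [|x /negPf-> //].
  rewrite sum_nat_const mulnC; congr (_ * _).
  by apply: eq_card => v; rewrite !inE eqbF_neg.
lia.
Qed.

Lemma card_sides : #|G| = side true + side false.
Proof.
rewrite /side -(cardsC [set v | col v == true]); congr (_ + _).
by apply: eq_card => v; rewrite !inE; case: (col v).
Qed.

Definition place (p q : nat) (s : bool) (k : nat) :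
    k < (if s then p else q) -> 'I_p + 'I_q :=
  match s return k < (if s then p else q) -> 'I_p + 'I_q with
  | true => fun lt => inl (Ordinal lt)
  | false => fun lt => inr (Ordinal lt)
  end.

Lemma bipartite_isomorphic p q :
  side true = p -> side false = q -> isomorphic G (complete_bipartite p q).
Proof.
move=> sp sq; pose m (s : bool) := if s then p else q.
have card s : #|[set v | col v == s]| = m s by case: s.
pose f v : complete_bipartite p q := place (rank_in_fiber card v).
exists f; split; last first.
  move=> v w; rewrite col_adj /f.
  move: (rank_in_fiber card v) (rank_in_fiber card w); rewrite /place.
  by case: (col v) (col w) => [] [].
have f_inj : injective f.
  move=> v w; rewrite /f => E; have [cE iE] : col v = col w /\
    index v (enum [set u | col u == col v]) = index w (enum [set u | col u == col w]).
    move: (rank_in_fiber card v) (rank_in_fiber card w) E.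
    move: (index v _) (index w _) => k l; rewrite /place.
    by case: (col v) (col w) => [] [] // lt lt' [].
  exact: rank_inj cE iE.
apply: inj_card_bij => //.
by rewrite card_sum !card_ord card_sides sp sq.
Qed.

End TriangleFree.

Lemma dense_bipartite_isomorphic (G : sgraph) (col : G -> bool) :
  (forall v w, adj v w = (col v != col w)) ->
  (#|G| ^ 2 %/ 4 <= #|edges G|)%N ->
  isomorphic G (balanced_complete_bipartite #|G|).
Proof.
move=> col_adj; rewrite (edges_sides col_adj) => dense.
have cG := card_sides col; move: dense; rewrite {1}cG cG.
set p := #|[set v | col v == true]|; set q := #|[set v | col v == false]|.
move: (sqr_div4 (p + q)) => sq dense.
have {sq}dense : ((p + q) ^ 2 <= 4 * (p * q) + odd (p + q))%N.
  by rewrite sq addnC [(_ * 4)%N]mulnC addnC leq_add2r leq_mul2l.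
have near : (p <= q.+1)%N /\ (q <= p.+1)%N.
  have : ((p - q) ^ 2 + (q - p) ^ 2 <= 1)%N.
    have : (odd (p + q) <= 1)%N by case: odd.
    have : ((p - q) ^ 2 + (q - p) ^ 2 + 4 * (p * q) = (p + q) ^ 2)%N by nia.
    lia.
  by split; nia.
have halves : (p = (p + q)./2 /\ q = uphalf (p + q)) \/
   (q = (p + q)./2 /\ p = uphalf (p + q)).
  rewrite uphalf_half; have := odd_double_half (p + q).
  case: near => ? ?; case: (odd _) (p + q)./2 => h /=; rewrite -addnn => ?.
    by have [?|?] := leqP p q; [left|right]; lia.
  by left; lia.
case: halves => [[pE qE]|[qE pE]].
  by apply: (bipartite_isomorphic col_adj).
apply: (@bipartite_isomorphic G (fun v => ~~ col v)).
- by move=> v w; rewrite col_adj; case: (col v) (col w) => [] [].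
- by rewrite -qE; apply: eq_card => v; rewrite !inE; case: (col v).
- by rewrite -pE; apply: eq_card => v; rewrite !inE; case: (col v).
Qed.

(** Without triangles there is no slack in [sum_uncut], so every vertex separates
every edge; the neighbourhood of any vertex that has a neighbour is then one side of a
bipartition. *)
Lemma triangle_free_isomorphic (G : sgraph) :
  (#|G| ^ 2 %/ 4 <= #|edges G|)%N -> (0 < #|edges G|)%N -> #|triangles G| = 0%N ->
  isomorphic G (balanced_complete_bipartite #|G|).
Proof.
move=> dense e_gt0 t0; have [R _] : exists R : realFieldType, True by exists rat.
have tau0 : tau R G = 0 by rewrite tau_card t0 mulr0.
have un0 (v : G) : 0 <= uncut R v.
  apply: sumr_ge0 => x _; apply: sumr_ge0 => y _; apply: mulr_ge0.
    exact: adjR_ge0.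
  exact: same_ge0.
have sum0 : \sum_(v : G) uncut R v = 0.
  apply/eqP; rewrite eq_le sumr_ge0 // andbT sum_uncut tau0 mulr0 sub0r oppr_le0.
  exact: surplus_ge0.
have cut (v x y : G) : adj x y -> adj v x != adj v y.
  move=> xy; have u0 : uncut R v = 0 by apply: (psumr_eq0P _ sum0).
  have u1 : \sum_y adjR R x y * same R v x y = 0.
    apply: (psumr_eq0P _ u0) => // z _; apply: sumr_ge0 => s _; apply: mulr_ge0.
      exact: adjR_ge0.
    exact: same_ge0.
  have : adjR R x y * same R v x y = 0.
    apply: (psumr_eq0P _ u1) => // s _; apply: mulr_ge0.
      exact: adjR_ge0.
    exact: same_ge0.
  rewrite /same /adjR xy mul1r; case: (adj v x) (adj v y) => [] [] //= /eqP.
  - by rewrite mulr1 subrr mul0r addr0 oner_eq0.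
  - by rewrite mul0r subr0 add0r mulr1 oner_eq0.
have [e eG] : exists e, e \in edges G by apply/card_gt0P.
move: eG; rewrite inE => /existsP[a /existsP[c /andP[ac _]]].
apply: (dense_bipartite_isomorphic (col := fun v => adj v a)) => // v w.
apply/idP/idP => [vw|]; first by rewrite !(adj_sym _ a) cut.
case va: (adj v a); case wa: (adj w a) => //= _.
  by have := cut w v a va; rewrite wa (adj_sym w v) eqbF_neg negbK.
by have := cut v w a wa; rewrite va eqbF_neg negbK.
Qed.

Lemma S_graph_triangles (G : sgraph) (b : nat) :
  (4 * b <= #|G|)%N ->
  isomorphic G (S_graph b #|G|) -> #|triangles G| = (b ^ 2 * (#|G| - 4 * b))%N.
Proof.
move=> n4 [f [bf adjE]]; have [R _] : exists R : realFieldType, True by exists rat.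
pose cls v : option prism := Some (tag (f v)).
have card c : class_size R cls (Some c) = (S_part_size b #|G| c)%:R.
  by rewrite /class_size -(fiber_card_blowup c bf); congr _%:R; apply: eq_card => v; rewrite !inE.
have : tau R G = (6 * (b ^ 2 * (#|G| - 4 * b)))%:R.
  have -> : tau R G = \sum_u \sum_v \sum_w pattern R cls u v * (pattern R cls u w * pattern R cls v w).
    apply: eq_bigr => u _; apply: eq_bigr => v _; apply: eq_bigr => w _.
    by rewrite mulr1 /adjR /pattern -!adjE.
  rewrite sum_pattern3 !card /S_part_size /= -[6]/(6%:R) -!natrM -natrD -natrM; congr _%:R.
  by rewrite -mulnDr mulnn uphalf_half addnCA addnn odd_double_half.
rewrite tau_card -[6]/(6%:R) -natrM => /eqP; rewrite eqr_nat eqn_mul2l /=.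
by move/eqP.
Qed.

Lemma flip_prismK f i : involutive (flip_prism f i).
Proof. by case=> s j; rewrite /flip_prism /= tpermK -addbA addbb addbF. Qed.

Lemma flip_prism_adj f i (c d : prism) : adj (flip_prism f i c) (flip_prism f i d) = adj c d.
Proof.
rewrite /= /prism_adj /flip_prism /= (inj_eq (can_inj (tpermK i ord_max))).
by have -> : (c.1 (+) f == d.1 (+) f) = (c.1 == d.1) by case: f c.1 d.1 => [] [] [].
Qed.

Lemma perfect_isomorphic (G : sgraph) (b : nat) (cls : G -> option prism) :
  (forall v, cls v != None) -> (forall v w, adj v w = oadj (cls v) (cls w)) ->
  S_sizes #|G| b (fun c => #|[set v | cls v == Some c]|) -> isomorphic G (S_graph b #|G|).
Proof.
move=> all adjE [f [i card]].
pose ty v : prism := flip_prism f i (odflt (false, i0) (cls v)).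
apply: (blowup_isomorphic (ty := ty)) => [v w|c].
  rewrite flip_prism_adj adjE.
  by case: (cls v) (all v) => // c _; case: (cls w) (all w).
rewrite -[in RHS](flip_prismK f i c) -card; apply: eq_card => v; rewrite !inE /ty.
case: (cls v) (all v) => // d _ /=; rewrite (inj_eq Some_inj).
by rewrite (can2_eq (flip_prismK f i) (flip_prismK f i)).
Qed.

Lemma no_holes (R : realFieldType) (G : sgraph) (cls : G -> option prism) :
  (forall v w c c', cls v = Some c -> cls w = Some c' -> adj v w -> adj c c') ->
  (forall v, cls v != None) -> holes R cls = 0 ->
  forall v w, adj v w = oadj (cls v) (cls w).
Proof.
move=> cls_adj all h0 v w.
have m0 : missing R cls v w = 0.
  have h1 : \sum_w missing R cls v w = 0.
    by apply: (psumr_eq0P _ h0) => // u _; apply: sumr_ge0 => s _; apply: missing_ge0.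
  by apply: (psumr_eq0P _ h1) => // u _; apply: missing_ge0.
apply/idP/idP => [vw|].
  case cv: (cls v) (all v) => [c|//] _; case cw: (cls w) (all w) => [d|//] _.
  exact: cls_adj cv cw vw.
move: m0; rewrite /missing /pattern /adjR => + vw; rewrite vw mul1r.
by case: adj => //= /eqP; rewrite subr0 oner_eq0.
Qed.

Lemma tolerances (R : realFieldType) (mu : R) (nu := 1 / 4000 : R) :
  0 < mu -> 10 ^+ 13 * mu <= 1 ->
  [/\ 0 < nu, 1000 * nu <= 1, 144 * (1100 * mu) <= 1, 52 * (1100 * mu) <= nu ^+ 2 &
      2 * (1100 * mu) <= nu].
Proof. by rewrite /nu => mu0 mu1; split; lra. Qed.

Section Extremal.
Variables (R : realFieldType) (G : sgraph) (b : nat) (mu : R).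
Local Notation n := #|G|.
Local Notation bR := (b%:R : R).
Hypothesis dense : (n ^ 2 %/ 4 <= #|edges G|)%N.
Hypothesis book : (book_number G <= b)%N.
Hypothesis b_gt0 : (0 < b)%N.
Hypothesis n_le : (n <= 6 * b)%N.
Hypothesis n_ge : (4 * b <= n)%N.
Hypothesis mu_gt0 : 0 < mu.
Hypothesis mu_le : 10 ^+ 13 * mu <= 1.
Hypothesis defect_le : 6 * bR - n%:R <= mu ^+ 2 * bR.
Hypothesis has_triangle : (0 < #|triangles G|)%N.
Hypothesis few : (#|triangles G| <= b ^ 2 * (n - 4 * b))%N.

Let cod_le (u v : G) : adj u v -> cod R u v <= bR.
Proof.
move=> uv; have -> : cod R u v = #|[set z | adj u z && adj v z]|%:R.
  rewrite /cod -sum1dep_card natr_sum [RHS]big_mkcond /=; apply: eq_bigr => z _.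
  by rewrite /adjR; case: adj; case: adj; rewrite ?mulr1 ?mulr0.
by rewrite ler_nat (leq_trans (common_nbrs_le_book uv)).
Qed.

Let b1 : 1 <= bR. Proof. by rewrite ler1n. Qed.
Let nR : n%:R <= 6 * bR. Proof. by rewrite -[6]/(6%:R) -natrM ler_nat. Qed.
Let bR0 : 0 < bR. Proof. by rewrite ltr0n. Qed.

Let oddn : (odd n)%:R <= 6 * bR - n%:R.
Proof.
rewrite -[6]/(6%:R) -natrM -natrB // ler_nat.
case: (boolP (odd n)) => // on; rewrite subn_gt0 ltn_neqAle n_le andbT.
by apply: contraL on => /eqP->; rewrite oddM.
Qed.

Lemma clean_structure : exists cls : G -> option prism,
  [/\ forall v w c c', cls v = Some c -> cls w = Some c' -> adj v w -> adj c c',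
      forall v, cls v = None -> 5 * deg R v <= 13 * bR &
      forall c, (1 - 1 / 1000) * bR <= class_size R cls (Some c)].
Proof.
have tau_gt0 : 0 < tau R G by rewrite tau_card mulr_gt0 // ltr0n.
have tau_le : tau R G <= 12 * bR ^+ 3.
  rewrite tau_card; have : #|triangles G|%:R <= (b ^ 2 * (2 * b))%:R :> R.
    by rewrite ler_nat (leq_trans few) // leq_mul2l; lia.
  by rewrite natrM natrX natrM; lra.
have mu2 : 2 * mu <= 1 by move: mu_le mu_gt0; lra.
have [x [y [z good]]] := good_triangle dense cod_le b1 nR mu_gt0 mu2 defect_le oddn tau_gt0 tau_le.
have [] := tolerances mu_gt0 mu_le.
set nu := 1 / 4000; move=> nu0 nu1 k1 k2 k3.
have k0 : 0 <= 1100 * mu by rewrite mulr_ge0 // ltW.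
have muu : mu ^+ 2 <= 1100 * mu.
  rewrite expr2 ler_wpM2r ?(ltW mu_gt0) //; move: mu2; lra.
have defect_k : 6 * bR - n%:R <= 1100 * mu * bR.
  by apply: le_trans defect_le _; rewrite ler_wpM2r // ltW.
have [none size missing] := @near_prism_colouring R G bR (1100 * mu) nu x y z dense cod_le b1 k0
k1 (ltW nu0) k2 k3 nR defect_k oddn good.
exists (clean bR nu (trace_cls x y z)); split.
- exact: (clean_adj cod_le bR0 nu0 nu1 none size missing).
- exact: (clean_None cod_le bR0 nu0 nu1 none size missing).
- move=> c; apply: le_trans (clean_size cod_le bR0 nu0 nu1 none size missing c).
  by rewrite le_eqVlt; apply/orP; left; apply/eqP; rewrite /nu; field.
Qed.

(** The assumption [few] serves only to find the structure; the count then shows that it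
can hold only with equality. *)
Lemma few_triangles :
  #|triangles G| = (b ^ 2 * (n - 4 * b))%N /\ isomorphic G (S_graph b n).
Proof.
have [cls [cls_adj low size]] := clean_structure.
have e0 : 0 <= 1 / 1000 :> R by lra.
have e1 : 1000 * (1 / 1000) <= 1 :> R by lra.
have defect_e : 6 * bR - n%:R <= 1 / 1000 * bR.
  apply: le_trans defect_le _; rewrite ler_wpM2r ?(ltW bR0) //.
  have : mu * mu <= 1 / 1000 * mu.
    by rewrite ler_wpM2r ?(ltW mu_gt0) //; move: mu_le mu_gt0; lra.
  by move: mu_le mu_gt0; lra.
have not_strict : ~~ (b ^ 2 * (n - 4 * b) < #|triangles G|)%N by rewrite -leqNgt.
have fit c : class_size R cls (Some c) <= bR.
  rewrite leNgt; apply: contra not_strict => over.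
  exact: (strict_over dense cod_le b_gt0 n_le n_ge e0 e1 defect_e cls_adj low size over).
have none0 : class_size R cls None = 0.
  apply/eqP; apply: contraNT not_strict => low0.
  exact: (strict_low dense b_gt0 n_le n_ge e0 e1 defect_e cls_adj low size fit low0).
have cubic0 := contraNT (strict_cubic dense b_gt0 n_le n_ge e0 e1 defect_e cls_adj low size fit none0) not_strict.
have {}cubic0 := eqP cubic0.
have tE : #|triangles G| = (b ^ 2 * (n - 4 * b))%N.
  apply/eqP; rewrite eqn_leq few.
  exact: (flat_le dense b_gt0 n_le n_ge e0 e1 defect_e cls_adj low size fit none0 cubic0).
split=> //.
have [h0 sizes] := flat_eq dense b_gt0 n_le n_ge e0 e1 defect_e cls_adj low size fit none0 cubic0 tE.
have all v : cls v != None.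
  apply/negP => /eqP vN; move: none0; rewrite /class_size => /eqP; rewrite pnatr_eq0 cards_eq0.
  by move=> /eqP/setP/(_ v); rewrite !inE vN eqxx.
exact: perfect_isomorphic all (no_holes cls_adj all h0) sizes.
Qed.

End Extremal.

Theorem theorem1p3 (R : realType) :
  exists eps : R, 0 < eps /\
    forall n b : nat, (0 < n)%N -> (0 < b)%N ->
      n%:R / 6 <= b%:R :> R -> b%:R < n%:R / 4 :> R ->
      b%:R <= (1 / 6 + eps) * n%:R ->
      forall G : sgraph,
        #|G| = n ->
        (n ^ 2 %/ 4 <= #|edges G|)%N ->
        (book_number G <= b)%N ->
        ~ isomorphic G (balanced_complete_bipartite n) ->
        (b ^ 2 * (n - 4 * b) <= #|triangles G|)%N /\
        (#|triangles G| = (b ^ 2 * (n - 4 * b))%N <-> isomorphic G (S_graph b n)).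
Proof.
(* The average badness of a triangle is of order [mu b^2], and the relative errors in
   the sizes of the parts are of the order of the square root of [mu]; any [mu] that
   makes these errors smaller than a thousandth would do. *)
pose mu : R := (10 ^+ 13)^-1.
have mu_gt0 : 0 < mu by rewrite invr_gt0 exprn_gt0.
exists (mu ^+ 2 / 36); split; first by rewrite divr_gt0 // exprn_gt0.
move=> n b _ b_gt0 nb6 nb4 beps G cG; rewrite -{}cG in nb6 nb4 beps *.
move=> dense book not_bip.
have n_le : (#|G| <= 6 * b)%N by rewrite -(ler_nat R) natrM; lra.
have n_gt : (4 * b < #|G|)%N by rewrite -(ltr_nat R) natrM; lra.
have mu_le : 10 ^+ 13 * mu <= 1 by rewrite /mu mulfV ?lexx // expf_neq0 // pnatr_eq0.
have defect_le : 6 * b%:R - #|G|%:R <= mu ^+ 2 * b%:R :> R.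
  have : mu ^+ 2 * #|G|%:R <= mu ^+ 2 * (6 * b%:R).
    by rewrite ler_wpM2l ?sqr_ge0 //; lra.
  lra.
have t_gt0 : (0 < #|triangles G|)%N.
  rewrite lt0n; apply/negP => /eqP t0; apply: not_bip.
  apply: triangle_free_isomorphic => //; apply: leq_trans dense.
  by rewrite divn_gt0 // (@leq_trans (2 ^ 2)) // leq_sqr; lia.
have few_case := few_triangles dense book b_gt0 n_le (ltnW n_gt) mu_gt0 mu_le defect_le t_gt0.
have S_tri := S_graph_triangles (ltnW n_gt).
split; last by split => [tE|//]; have [|//] := few_case; rewrite tE.
rewrite leqNgt; apply/negP => lt; have [tE _] := few_case (ltnW lt).
by rewrite tE ltnn in lt.
Qed.
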